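(* Let $k\in\mathbb{N}$ and let $G$ be a reduced algebraic plumbing graph of rank $2$. Then: (a) If $G$ is spin, then $G$ is one of the following: (i) two isolated vertices $u_1,u_2\in U$ with labels $(\alpha_1;0,0)$ and $(\alpha_2;0,0)$ (and $V=\emptyset$), with $\alpha_1,\alpha_2\in\mathbb{Z}$; or (ii) the star with one vertex $v\in V$ and three vertices $u_1,u_2,u_3\in U$ with labels $(\alpha_i;0,0)$, $\alpha_i\in\mathbb{Z}\setminus\{0\}$, each joined to $v$ by an edge. For every such graph $G$ there is at most one reduced class that is $k$-equivalent but not equal to that of $G$. (b) If $G$ is not spin, then its reduced class is equal to that of one of the following graphs, for some $\alpha\in\mathbb{Z}$: (i) the disjoint union of the graph consisting of one vertex $v\in V$ and one vertex $u\in U$ with label $(0;1,0)$ joined by an edge, and of a single isolated vertex in $U$ with label $(\alpha;0,0)$; or (ii) a single vertex in $U$ with label $(\alpha;1,0)$ (and $V=\emptyset$). For every such graph $G$, every reduced class that is $k$-equivalent to that of $G$ is equal to that of $G$.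
   Context: Conventions: $\mathbb{N}=\{1,2,\dots\}$, $\mathbb{N}_0=\mathbb{N}\cup\{0\}$. Algebraic plumbing graphs. An algebraic plumbing graph $G=(U,V,E,(\alpha,k^+,k^-))$ is a finite bipartite graph with vertex sets $U,V$, edges $E\subseteq U\times V$ and a labeling $(\alpha,k^+,k^-)\colon U\to\mathbb{Z}\times\mathbb{N}_0^2$; we say $u$ has label $(\alpha(u);k^+(u),k^-(u))$. Put $\nu_k=2$ for $k=1,4$, $\nu_2=8$, $\nu_k=1$ for $k=3$ or $k>4$, and $\lambda_k=\nu_k\frac{3-(-1)^k}{2}(2k-1)!$. For each $u\in U$ introduce symbols $u^i$, $-k^-(u)\le i\le k^+(u)$, and let $A=\bigoplus_{u\in U}\bigoplus_{i=-k^-(u)}^{k^+(u)}\mathbb{Z}u^i$. Let $\mu^k$ be the symmetric trilinear form on $A$ with, for $i,j,l\ne0$: $\mu^k(u^0,u^0,u^0)=\frac{\lambda_k}{4}\alpha(u)$, $\mu^k(u^0,u^0,u^l)=0$, $\mu^k(u^0,u^j,u^l)=\mathrm{sgn}(j)$ if $j=l$ and $0$ otherwise, $\mu^k(u^i,u^j,u^l)=0$, and $\mu^k=0$ on triples of symbols not all belonging to the same $u$. Let $p^k(u^0)=\lambda_k\alpha(u)+\binom{2k+1}{k}(k^+(u)-k^-(u))$ and $p^k(u^j)=0$ for $j\neq0$. Let $w_G=\sum_{u\in U,i\ne0}u^i \bmod 2$. Let $$H_G=\bigoplus_{u\in U,\,i\ne0}\mathbb{Z}u^i\oplus\Big\{\sum_{u\in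 U}\lambda_u u^0\;\Big|\;\lambda_u\in\mathbb{Z},\ \sum_{u:(u,v)\in E}\lambda_u=0\ \forall v\in V\Big\}\subseteq A,$$ and let $\mu_G^k,p_G^k$ be the restrictions of $\mu^k,p^k$ to $H_G$. The rank of $G$ is $\mathrm{rank}(H_G)$. $G$ is spin if $k^+=k^-\equiv0$. $G$ and $G'$ are $k$-equivalent if there is an isomorphism $\phi\colon H_G\to H_{G'}$ with $\phi^*\mu^k_{G'}=\mu^k_G$, $\phi(w_G)=w_{G'}$, $\phi^*p^k_{G'}=p^k_G$. Reduced graphs. Let $\Theta$ be the graph with one $v\in V$ and one $u\in U$ labeled $(0;1,0)$, joined by an edge. $G$ is reduced if: every connected component of $G$ is simply-connected (a tree); $\Theta$ appears as a connected component of $G$ only if it is the only non-spin connected component; every $v\in V$ not contained in this component $\Theta$ has degree at least $3$; and every $u\in U$ with label $(0;0,0)$ has degree $0$ or at least $3$. For a graph $G$, $-G$ denotes $G$ with $\alpha$ replaced by $-\alpha$ and $(k^+,k^-)$ replaced by $(k^-,k^+)$. The reduced class of a reduced graph $G$ is the set of isomorphism classes of reduced graphs obtained from $G$ by multiplying each connected component by $+1$ or $-1$. Reduced graphs with the same reduced class are $k$-equivalent, so $k$-equivalence is well defined for reduced classes. *)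

(* Defs.v *)
From HB Require Import structures.
From mathcomp Require Import all_boot all_order all_algebra.

Set Implicit Arguments.
Unset Strict Implicit.
Unset Printing Implicit Defensive.

Import Order.TTheory GRing.Theory Num.Theory.
Local Open Scope ring_scope.

Record plumbing_graph := PlumbingGraph {
  gU : finType;
  gV : finType;
  gE : gU -> gV -> bool;
  galpha : gU -> int;
  gkp : gU -> nat;
  gkm : gU -> nat
}.

Definition spin (G : plumbing_graph) : Prop :=
  forall u : gU G, gkp u = 0%N /\ gkm u = 0%N.

Definition graph_iso (G G' : plumbing_graph) : Prop :=
  exists (f : gU G -> gU G') (g : gV G -> gV G'),
    [/\ bijective f, bijective g,
        forall u v, gE (f u) (g v) = gE u v
      & forall u, [/\ galpha (f u) = galpha u,
                      gkp (f u) = gkp u & gkm (f u) = gkm u]].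

(** Vertices, adjacency and connected components *)

Definition vertex (G : plumbing_graph) : finType := (gU G + gV G)%type.

Definition adj (G : plumbing_graph) : rel (vertex G) :=
  fun x y => match x, y with
             | inl u, inr v => gE u v
             | inr v, inl u => gE u v
             | _, _ => false
             end.

Definition degU (G : plumbing_graph) (u : gU G) : nat := #|[set v | gE u v]|.
Definition degV (G : plumbing_graph) (v : gV G) : nat := #|[set u | gE u v]|.

(* The connected component of [x], as a plumbing graph. *)
Definition component (G : plumbing_graph) (x : vertex G) : plumbing_graph :=
  @PlumbingGraph {u : gU G | connect (@adj G) x (inl u)}
                 {v : gV G | connect (@adj G) x (inr v)}
                 (fun u v => gE (val u) (val v))
                 (fun u => galpha (val u))
                 (fun u => gkp (val u))
                 (fun u => gkm (val u)).

(* Edges form a subset of U x V, so there are no multiple edges, and a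
   duplicate-free closed walk on at least three vertices is a genuine cycle;
   [ucycle] also accepts the degenerate closed walk x, y, x along one edge. *)
Definition acyclic (G : plumbing_graph) : Prop :=
  forall c : seq (vertex G), ucycle (@adj G) c -> (size c <= 2)%N.

Definition isolated_vertex (a : int) (p m : nat) : plumbing_graph :=
  @PlumbingGraph unit void (fun _ _ => false)
                 (fun _ => a) (fun _ => p) (fun _ => m).

Definition Theta : plumbing_graph :=
  @PlumbingGraph unit unit (fun _ _ => true)
                 (fun _ => 0) (fun _ => 1%N) (fun _ => 0%N).

Definition star3 (a : 'I_3 -> int) : plumbing_graph :=
  @PlumbingGraph 'I_3 unit (fun _ _ => true)
                 a (fun _ => 0%N) (fun _ => 0%N).

Definition disjoint_union (G G' : plumbing_graph) : plumbing_graph :=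
  @PlumbingGraph (gU G + gU G')%type (gV G + gV G')%type
    (fun u v => match u, v with
                | inl u, inl v => gE u v
                | inr u, inr v => gE u v
                | _, _ => false
                end)
    (fun u => match u with inl u => galpha u | inr u => galpha u end)
    (fun u => match u with inl u => gkp u | inr u => gkp u end)
    (fun u => match u with inl u => gkm u | inr u => gkm u end).

(** Reduced graphs and reduced classes *)

(* Components are connected by construction, so [acyclic] makes them trees. *)
Definition reduced (G : plumbing_graph) : Prop :=
  [/\ forall x : vertex G, acyclic (component x),
      forall x : vertex G, graph_iso (component x) Theta ->
        forall y : vertex G, ~ spin (component y) -> connect (@adj G) x y,
      forall v : gV G,
        ~ graph_iso (@component G (inr v)) Theta -> (3 <= degV v)%N
    & forall u : gU G, galpha u = 0 -> gkp u = 0%N -> gkm u = 0%N ->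
        degU u = 0%N \/ (3 <= degU u)%N].

(* Replace a label (a; p, m) by (- a; m, p) at the vertices where [s] holds. *)
Definition sign_change (G : plumbing_graph) (s : vertex G -> bool) :
    plumbing_graph :=
  @PlumbingGraph (gU G) (gV G) (@gE G)
    (fun u => if s (inl u) then - galpha u else galpha u)
    (fun u => if s (inl u) then gkm u else gkp u)
    (fun u => if s (inl u) then gkp u else gkm u).

(* A set of isomorphism classes is an isomorphism-invariant predicate. *)
Definition reduced_class (G : plumbing_graph) : plumbing_graph -> Prop :=
  fun K => reduced K /\
    exists s : vertex G -> bool,
      (forall x y, connect (@adj G) x y -> s x = s y) /\
      graph_iso K (sign_change s).

Definition eq_reduced_class (G G' : plumbing_graph) : Prop :=
  forall K, reduced_class G K <-> reduced_class G' K.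

(** The group A, its forms, and the subgroup H_G *)

(* The symbol u^i with - k^-(u) <= i <= k^+(u) is stored as
   the pair of u and the natural number i + k^-(u). *)
Definition symb (G : plumbing_graph) : finType :=
  {u : gU G & 'I_(gkm u + gkp u).+1}.

Definition symb_idx (G : plumbing_graph) (s : symb G) : int :=
  (tagged s : nat)%:Z - (gkm (tag s))%:Z.

Definition symb0 (G : plumbing_graph) (u : gU G) : symb G :=
  Tagged (fun u : gU G => 'I_(gkm u + gkp u).+1)
    (@Ordinal (gkm u + gkp u).+1 (gkm u) (leq_addr (gkp u) (gkm u))).

Lemma symb_idx0 (G : plumbing_graph) (u : gU G) : symb_idx (symb0 u) = 0.
Proof. by rewrite /symb_idx /= subrr. Qed.

Definition lattA (G : plumbing_graph) : zmodType := {ffun symb G -> int}.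

Definition nu (k : nat) : nat :=
  if k == 2 then 8 else if (k == 1) || (k == 4) then 2 else 1.

(* The factor (3 - (-1)^k) / 2 is 2 for odd k and 1 for even k. *)
Definition lambda (k : nat) : nat :=
  (nu k * (if odd k then 2 else 1) * (2 * k - 1)`!)%N.

(* Hence the natural number quotient lambda_k / 4 used below is exact. *)
Lemma dvdn4_lambda (k : nat) : (0 < k)%N -> (4 %| lambda k)%N.
Proof.
case: k => [|[|[|k]]] // _.
apply/dvdn_mull/dvdn_fact.
by rewrite !mulnS.
Qed.

(* The value of mu^k on u^i, u^j, u^l where u has first label a. *)
Definition mu_idx (k : nat) (a i j l : int) : int :=
  if (i == 0) && (j == 0) && (l == 0) then (lambda k %/ 4)%:Z * a
  else if (i == 0) && (j == l) then Num.sg j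
  else if (j == 0) && (i == l) then Num.sg i
  else if (l == 0) && (i == j) then Num.sg i
  else 0.

Definition mu_symb (k : nat) (G : plumbing_graph) (r s t : symb G) : int :=
  if (tag r == tag s) && (tag s == tag t)
  then mu_idx k (galpha (tag r)) (symb_idx r) (symb_idx s) (symb_idx t)
  else 0.

Definition muA (k : nat) (G : plumbing_graph) (x y z : lattA G) : int :=
  \sum_(r : symb G) \sum_(s : symb G) \sum_(t : symb G)
    x r * y s * z t * mu_symb k r s t.

Definition p_symb (k : nat) (G : plumbing_graph) (s : symb G) : int :=
  let u := tag s in
  if symb_idx s == 0
  then (lambda k)%:Z * galpha u
       + 'C(2 * k + 1, k)%:Z * ((gkp u)%:Z - (gkm u)%:Z)
  else 0.

Definition pA (k : nat) (G : plumbing_graph) (x : lattA G) : int :=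
  \sum_(s : symb G) x s * p_symb k s.

(* The coefficients on the u^i with i != 0 are unconstrained. *)
Definition inH (G : plumbing_graph) : {pred lattA G} :=
  fun x => [forall v : gV G, \sum_(u : gU G | gE u v) x (symb0 u) == 0].

Lemma inH_zmod_closed (G : plumbing_graph) : zmod_closed (@inH G).
Proof.
split=> [|x y /forallP hx /forallP hy]; apply/forallP => v.
  by rewrite big1 // => u _; rewrite ffunE.
under eq_bigr => u _ do rewrite !ffunE.
by rewrite sumrB (eqP (hx v)) (eqP (hy v)) subrr.
Qed.

HB.instance Definition _ (G : plumbing_graph) :=
  GRing.isZmodClosed.Build (lattA G) (@inH G) (inH_zmod_closed G).

Record lattH (G : plumbing_graph) :=
  LattH { valH : lattA G; _ : valH \in @inH G }.

HB.instance Definition _ (G : plumbing_graph) := [isSub for @valH G].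
HB.instance Definition _ (G : plumbing_graph) :=
  [Choice of lattH G by <:].
HB.instance Definition _ (G : plumbing_graph) :=
  [SubChoice_isSubZmodule of lattH G by <:].

Definition muH (k : nat) (G : plumbing_graph) (x y z : lattH G) : int :=
  muA k (valH x) (valH y) (valH z).

Definition pH (k : nat) (G : plumbing_graph) (x : lattH G) : int :=
  pA k (valH x).

(* The sum of all u^i with i != 0; w_G is its class in H_G / 2 H_G. *)
Definition w_sum (G : plumbing_graph) : lattA G :=
  [ffun s => if symb_idx s == 0 then 0 else 1].

Lemma w_sum_inH (G : plumbing_graph) : w_sum G \in @inH G.
Proof.
by apply/forallP => v; rewrite big1 // => u _; rewrite ffunE symb_idx0 eqxx.
Qed.

Definition wH (G : plumbing_graph) : lattH G := LattH (w_sum_inH G).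

Definition eq_mod2 (M : zmodType) (x y : M) : Prop :=
  exists z : M, x - y = z *+ 2.

Definition free_of_rank (M : zmodType) (n : nat) : Prop :=
  exists b : 'I_n -> M,
    forall x : M, exists! c : {ffun 'I_n -> int}, x = \sum_(i < n) b i *~ c i.

Definition has_rank (G : plumbing_graph) (n : nat) : Prop :=
  free_of_rank (lattH G) n.

Definition k_equivalent (k : nat) (G G' : plumbing_graph) : Prop :=
  exists phi : {additive lattH G -> lattH G'},
    [/\ bijective phi,
        forall x y z, muH k (phi x) (phi y) (phi z) = muH k x y z,
        eq_mod2 (phi (wH G)) (wH G')
      & forall x, pH k (phi x) = pH k x].

(* Main.v *)
From HB Require Import structures.
Require Import Defs.
From mathcomp Require Import all_boot all_order all_algebra.
From mathcomp Require Import perm zify ring lra.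
From Stdlib Require Import Classical_Prop.
Set Implicit Arguments.
Unset Strict Implicit.
Unset Printing Implicit Defensive.
Import Order.TTheory GRing.Theory Num.Theory.
Local Open Scope ring_scope.

(** A forest has fewer edges than vertices, every [v] outside [Theta] has degree
    at least 3, and the rank of [H_G] is at least the number of symbols minus
    the number of [v]'s; comparing these bounds leaves only the listed graphs
    in rank 2.

    For spin graphs, [H_G] has coordinates in which [mu] and [p] are a fixed
    multiple of the sums of [a_i l_i ^ 3] and of [a_i l_i], where [l_1] and
    [l_2] form a basis of linear forms and [l_1 + l_2 + l_3 = 0] (an isolated
    pair has [a_3 = 0]).  Let [e_i] be the elementary symmetric functions of
    the [a_i].  The discriminants and resultants of the Hessian, of the cubic
    and of the linear form show that [e_1 e_3], [e_2 ^ 2] and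
    [(e_1 V) ^ 2], with [V] the Vandermonde product, are invariant.  The
    formula for the discriminant [V ^ 2] then says that [e_2 e_1 ^ 2] is a root
    of a quadratic polynomial with invariant coefficients, hence takes at most
    two values, and each value determines the reduced class.  If [e_1 = 0],
    where [e_3] cannot be recovered from [e_1 e_3], the cubic is the linear
    form times [x ^ 2 + x y + y ^ 2], whose finite automorphism group
    permutes the [l_i] up to a common sign.

    In the non-spin case the two families are told apart by the degeneracy of
    [mu], and [mu] determines [alpha] up to the sign changes allowed in a
    reduced class. *)

(** * Binary cubic forms with a linear form *)

(* On the kernel lattice of a star the third coordinate is [- (x.1 + x.2)]. *)
Definition cubic (a1 a2 a3 : int) (x y z : int * int) : int :=
  a1 * x.1 * y.1 * z.1 + a2 * x.2 * y.2 * z.2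
  - a3 * (x.1 + x.2) * (y.1 + y.2) * (z.1 + z.2).

Definition linform (a1 a2 a3 : int) (x : int * int) : int :=
  a1 * x.1 + a2 * x.2 - a3 * (x.1 + x.2).

Definition mxact (m11 m12 m21 m22 : int) (x : int * int) : int * int :=
  (m11 * x.1 + m12 * x.2, m21 * x.1 + m22 * x.2).

(** Equivalence under GL_2(Z): the squared determinant condition says that the determinant is 1 or
    -1. *)
Definition triple_equiv (a1 a2 a3 b1 b2 b3 : int) : Prop :=
  exists m11 m12 m21 m22 : int,
    [/\ (m11 * m22 - m12 * m21) ^+ 2 = 1,
        forall x y z, cubic b1 b2 b3 (mxact m11 m12 m21 m22 x)
            (mxact m11 m12 m21 m22 y) (mxact m11 m12 m21 m22 z)
          = cubic a1 a2 a3 x y z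
      & forall x, linform b1 b2 b3 (mxact m11 m12 m21 m22 x)
          = linform a1 a2 a3 x].

Definition sig1 (a1 a2 a3 : int) := a1 + a2 + a3.
Definition sig2 (a1 a2 a3 : int) := a1 * a2 + a1 * a3 + a2 * a3.
Definition sig3 (a1 a2 a3 : int) := a1 * a2 * a3.
Definition vdm (a1 a2 a3 : int) := (a1 - a2) * (a2 - a3) * (a1 - a3).

(** Testing the identities on basis vectors leaves the four coefficients of the binary cubic and the
    two of the linear form. *)
Lemma triple_equivE a1 a2 a3 b1 b2 b3 :
  triple_equiv a1 a2 a3 b1 b2 b3 ->
  exists m11 m12 m21 m22 : int,
   [/\ (m11 * m22 - m12 * m21) ^+ 2 = 1,
       [/\ a1 - a3 = b1 * m11 ^+ 3 + b2 * m21 ^+ 3 - b3 * (m11 + m21) ^+ 3,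
       - a3 = b1 * m11 ^+ 2 * m12 + b2 * m21 ^+ 2 * m22
                 - b3 * (m11 + m21) ^+ 2 * (m12 + m22),
       - a3 = b1 * m11 * m12 ^+ 2 + b2 * m21 * m22 ^+ 2
                 - b3 * (m11 + m21) * (m12 + m22) ^+ 2
     & a2 - a3 = b1 * m12 ^+ 3 + b2 * m22 ^+ 3 - b3 * (m12 + m22) ^+ 3],
       a1 - a3 = b1 * m11 + b2 * m21 - b3 * (m11 + m21)
     & a2 - a3 = b1 * m12 + b2 * m22 - b3 * (m12 + m22)].
Proof.
move=> [m11 [m12 [m21 [m22 [dt hF hL]]]]].
exists m11, m12, m21, m22; rewrite /cubic /linform /mxact /= in hF hL *.
have e1 := hF (1, 0) (1, 0) (1, 0).
have e2 := hF (1, 0) (1, 0) (0, 1).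
have e3 := hF (1, 0) (0, 1) (0, 1).
have e4 := hF (0, 1) (0, 1) (0, 1).
have l1 := hL (1, 0); have l2 := hL (0, 1).
rewrite /= in e1 e2 e3 e4 l1 l2.
split=> //; first split.
- by transitivity (a1*1*1*1 + a2*0*0*0 - a3*(1+0)*(1+0)*(1+0)); [ring|rewrite -e1; ring].
- by transitivity (a1*1*1*0 + a2*0*0*1 - a3*(1+0)*(1+0)*(0+1)); [ring|rewrite -e2; ring].
- by transitivity (a1*1*0*0 + a2*0*1*1 - a3*(1+0)*(0+1)*(0+1)); [ring|rewrite -e3; ring].
- by transitivity (a1*0*0*0 + a2*1*1*1 - a3*(0+1)*(0+1)*(0+1)); [ring|rewrite -e4; ring].
- by transitivity (a1*1 + a2*0 - a3*(1+0)); [ring|rewrite -l1; ring].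
- by transitivity (a1*0 + a2*1 - a3*(0+1)); [ring|rewrite -l2; ring].
Qed.


(** Write e_i for [sig1], [sig2], [sig3], V for [vdm], and d for the determinant. The discriminant
    of the Hessian is e_2^2 - 4 e_1 e_3. At the zero (L2, -L1) of the linear form, the Hessian and
    the cubic take the values -(e_2^2 - 3 e_1 e_3) and -e_1 V. All three are covariants, so they
    change by powers of d only, and d^2 = 1. *)
Lemma triple_equiv_inv a1 a2 a3 b1 b2 b3 :
  triple_equiv a1 a2 a3 b1 b2 b3 ->
  [/\ sig1 a1 a2 a3 * sig3 a1 a2 a3 = sig1 b1 b2 b3 * sig3 b1 b2 b3,
      sig2 a1 a2 a3 ^+ 2 = sig2 b1 b2 b3 ^+ 2
    & (sig1 a1 a2 a3 * vdm a1 a2 a3) ^+ 2 = (sig1 b1 b2 b3 * vdm b1 b2 b3) ^+ 2].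
Proof.
case/triple_equivE=> [p [q [r [s [dt [c0 c1 c2 c3] l1 l2]]]]].
set d := p * s - q * r in dt.
set C0 := (X in _ = X) in c0; set C1 := (X in _ = X) in c1.
set C2 := (X in _ = X) in c2; set C3 := (X in _ = X) in c3.
set L1 := (X in _ = X) in l1; set L2 := (X in _ = X) in l2.
(* Coefficients of the Hessian covariant. *)
have h0 : C0 * C2 - C1 ^+ 2 = d ^+ 2 * (- (b1 * b3) * p ^+ 2
    + (b1 * b2 - b3 * (b1 + b2)) * p * r - b2 * b3 * r ^+ 2).
  by rewrite /C0 /C1 /C2 /d; ring.
have h2 : C1 * C3 - C2 ^+ 2 = d ^+ 2 * (- (b1 * b3) * q ^+ 2
    + (b1 * b2 - b3 * (b1 + b2)) * q * s - b2 * b3 * s ^+ 2).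
  by rewrite /C3 /C1 /C2 /d; ring.
have h1 : C0 * C3 - C1 * C2 = d ^+ 2 * (- (b1 * b3) * (2 * p * q)
    + (b1 * b2 - b3 * (b1 + b2)) * (p * s + q * r) - b2 * b3 * (2 * r * s)).
  by rewrite /C0 /C1 /C2 /C3 /d; ring.
rewrite dt !mul1r in h0 h1 h2.
have g0 : - (a1 * a3) = C0 * C2 - C1 ^+ 2 by rewrite -c0 -c1 -c2; ring.
have g1 : a1 * a2 - a3 * (a1 + a2) = C0 * C3 - C1 * C2.
  by rewrite -c0 -c1 -c2 -c3; ring.
have g2 : - (a2 * a3) = C1 * C3 - C2 ^+ 2 by rewrite -c3 -c1 -c2; ring.
rewrite h0 in g0; rewrite h1 in g1; rewrite h2 in g2.
have eD : sig2 a1 a2 a3 ^+ 2 - 4 * (sig1 a1 a2 a3 * sig3 a1 a2 a3)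
        = sig2 b1 b2 b3 ^+ 2 - 4 * (sig1 b1 b2 b3 * sig3 b1 b2 b3).
  transitivity ((a1 * a2 - a3 * (a1 + a2)) ^+ 2
     - 4 * (- (a1 * a3)) * (- (a2 * a3))); first by rewrite /sig1 /sig2 /sig3; ring.
  rewrite g0 g1 g2; transitivity (d ^+ 2 *
     (sig2 b1 b2 b3 ^+ 2 - 4 * (sig1 b1 b2 b3 * sig3 b1 b2 b3))).
    by rewrite /d /sig1 /sig2 /sig3; ring.
  by rewrite dt mul1r.
have eH : sig2 a1 a2 a3 ^+ 2 - 3 * (sig1 a1 a2 a3 * sig3 a1 a2 a3)
        = sig2 b1 b2 b3 ^+ 2 - 3 * (sig1 b1 b2 b3 * sig3 b1 b2 b3).
  transitivity (- (- (a1 * a3) * L2 ^+ 2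
     - (a1 * a2 - a3 * (a1 + a2)) * L2 * L1 + - (a2 * a3) * L1 ^+ 2)).
    by rewrite -l1 -l2 /sig1 /sig2 /sig3; ring.
  rewrite g0 g1 g2; transitivity (d ^+ 2 *
     (sig2 b1 b2 b3 ^+ 2 - 3 * (sig1 b1 b2 b3 * sig3 b1 b2 b3))).
    by rewrite /L1 /L2 /d /sig1 /sig2 /sig3; ring.
  by rewrite dt mul1r.
have eR : sig1 a1 a2 a3 * vdm a1 a2 a3 = d ^+ 3 * (sig1 b1 b2 b3 * vdm b1 b2 b3).
  transitivity (- (C0 * L2 ^+ 3 - 3 * C1 * L2 ^+ 2 * L1
     + 3 * C2 * L2 * L1 ^+ 2 - C3 * L1 ^+ 3)).
    by rewrite -c0 -c1 -c2 -c3 -l1 -l2 /sig1 /vdm; ring.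
  (* The matrix sends the zero (L2, -L1) of the first linear form to d times the zero (b2 - b3, -(b1
     - b3)) of the second. *)
  have u : p * L2 - q * L1 = d * (b2 - b3) by rewrite /L1 /L2 /d; ring.
  have v : r * L2 - s * L1 = - (d * (b1 - b3)) by rewrite /L1 /L2 /d; ring.
  transitivity (- (b1 * (p * L2 - q * L1) ^+ 3 + b2 * (r * L2 - s * L1) ^+ 3
      - b3 * ((p * L2 - q * L1) + (r * L2 - s * L1)) ^+ 3)).
    by rewrite /C0 /C1 /C2 /C3; move: L1 L2 {l1 l2 u v eH} => L1 L2; ring.
  by rewrite u v /sig1 /vdm; move: (d) => D; ring.
split.
- by move: eD eH; clear => eD eH; lra.
- by move: eD eH; clear => eD eH; lra.
- by rewrite eR [LHS]exprMn -exprM mulnC exprM dt expr1n mul1r.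
Qed.


(** The discriminant formula V^2 = e_1^2 e_2^2 - 4 e_2^3 - 4 e_1^3 e_3 + 18 e_1 e_2 e_3 - 27 e_3^2,
    multiplied by e_1^2. The grouping isolates the invariants t, s^2 and e_1 V; multiplying by s^2
    turns it into a quadratic equation for s E. *)
Lemma sig_quadratic a1 a2 a3 :
  let E := sig1 a1 a2 a3 ^+ 2 in let t := sig1 a1 a2 a3 * sig3 a1 a2 a3 in
  let s := sig2 a1 a2 a3 in
  (s ^+ 2 - 4 * t) * E ^+ 2 + (18 * t - 4 * s ^+ 2) * (s * E)
  = 27 * t ^+ 2 + (sig1 a1 a2 a3 * vdm a1 a2 a3) ^+ 2.
Proof. by rewrite /= /sig1 /sig2 /sig3 /vdm; ring. Qed.

Lemma sqr_inj (x y : int) : 0 <= x -> 0 <= y -> x ^+ 2 = y ^+ 2 -> x = y.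
Proof. by move=> hx hy /eqP; rewrite eqrXn2 // => /eqP. Qed.

Lemma sqr_sum0 (x y z : int) : x ^+ 2 + y ^+ 2 + z ^+ 2 = 0 -> [/\ x = 0, y = 0 & z = 0].
Proof. by move=> h; split; nia. Qed.

(** Here 2 e_2 is minus the sum of the squares of the labels. The sign recovers e_2 from its
    square. *)
Lemma sig1_eq0_sig2_le0 a1 a2 a3 : sig1 a1 a2 a3 = 0 -> sig2 a1 a2 a3 <= 0.
Proof. by rewrite /sig1 /sig2 => h; nia. Qed.

(** If e_1 = 0, the sum of squares e_1^2 - 2 e_2 vanishes; if one label is 0, then e_2 is the
    product of the other two. This is the case in which the quadratic relation gives no information
    on e_1. *)
Lemma sig_degenerate a1 a2 a3 :
  sig1 a1 a2 a3 * sig3 a1 a2 a3 = 0 -> sig2 a1 a2 a3 = 0 ->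
  [\/ a1 = 0 /\ a2 = 0, a1 = 0 /\ a3 = 0 | a2 = 0 /\ a3 = 0].
Proof.
rewrite /sig1 /sig2 /sig3 => /eqP; rewrite !mulf_eq0 => h hs.
case/orP: h => [/eqP h|/orP[/orP[]|] /eqP h].
- have [-> -> _] : [/\ a1 = 0, a2 = 0 & a3 = 0] by apply: sqr_sum0; nia.
  by constructor 1.
- subst; have /eqP : a2 * a3 = 0 by lia.
  by rewrite mulf_eq0 => /orP[] /eqP ->; [constructor 1|constructor 2].
- subst; have /eqP : a1 * a3 = 0 by lia.
  by rewrite mulf_eq0 => /orP[] /eqP ->; [constructor 1|constructor 3].
- subst; have /eqP : a1 * a2 = 0 by lia.
  by rewrite mulf_eq0 => /orP[] /eqP ->; [constructor 2|constructor 3].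
Qed.

(** At most one label is nonzero on each side, so up to sign [sig1] is the gcd of the coefficients
    of the linear form. An integral substitution keeps these coefficients divisible by that gcd. *)
Lemma triple_equiv_degenerate_dvd a1 a2 a3 b1 b2 b3 :
  triple_equiv a1 a2 a3 b1 b2 b3 ->
  sig1 a1 a2 a3 * sig3 a1 a2 a3 = 0 -> sig2 a1 a2 a3 = 0 ->
  sig1 b1 b2 b3 * sig3 b1 b2 b3 = 0 -> sig2 b1 b2 b3 = 0 ->
  (sig1 b1 b2 b3 %| sig1 a1 a2 a3)%Z.
Proof.
case/triple_equivE=> [p [q [r [s [_ _ l1 l2]]]]].
move=> ha1 ha2 hb1 hb2.
have b_dvd : (sig1 b1 b2 b3 %| b1 - b3)%Z && (sig1 b1 b2 b3 %| b2 - b3)%Z.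
  case: (sig_degenerate hb1 hb2) => [] [-> ->]; rewrite /sig1 ?(subr0, sub0r, addr0, add0r);
    by rewrite !dvdzE ?abszN ?dvdnn ?dvdn0.
case/andP: b_dvd => d1 d2.
have e1 : (sig1 b1 b2 b3 %| a1 - a3)%Z.
  have -> : a1 - a3 = (b1 - b3) * p + (b2 - b3) * r by rewrite l1; ring.
  by rewrite rpredD // dvdz_mulr.
have e2 : (sig1 b1 b2 b3 %| a2 - a3)%Z.
  have -> : a2 - a3 = (b1 - b3) * q + (b2 - b3) * s by rewrite l2; ring.
  by rewrite rpredD // dvdz_mulr.
case: (sig_degenerate ha1 ha2) => [] [h h']; move: e1 e2; rewrite h h' /sig1;
  by rewrite ?(subr0, sub0r, addr0, add0r) ?dvdzE ?abszN.
Qed.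

(** These are the six units of the Eisenstein integers. The form is (2 x + y)^2 + 3 y^2 over 4,
    which bounds both variables by 1. *)
Lemma hex_unit (x y : int) : x ^+ 2 + x * y + y ^+ 2 = 1 ->
  [\/ [\/ (x, y) = (1, 0), (x, y) = (0, 1) | (x, y) = (1, -1)]
    | [\/ (x, y) = (-1, 0), (x, y) = (0, -1) | (x, y) = (-1, 1)]].
Proof.
move=> h.
have hx : -1 <= x <= 1 by nia.
have hy : -1 <= y <= 1 by nia.
have [hx'|[hx'|hx']] : x = -1 \/ x = 0 \/ x = 1 by lia.
all: have [hy'|[hy'|hy']] : y = -1 \/ y = 0 \/ y = 1 by lia.
all: subst x y.
all: try by exfalso; lia.
all: first [ by left; constructor 1 | by left; constructor 2 | by left; constructor 3
  | by right; constructor 1 | by right; constructor 2 | by right; constructor 3 ].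
Qed.

(** The quadratic hypotheses say that the matrix with columns (p, r) and (q, s) preserves x^2 + x y
    + y^2. Both columns are units, and the polarised condition leaves twelve pairs, each of which
    permutes the labels up to a common sign. *)
Lemma hex_aut_sig3 a1 a2 a3 b1 b2 b3 (p q r s : int) :
  sig1 a1 a2 a3 = 0 -> sig1 b1 b2 b3 = 0 ->
  p ^+ 2 + p * r + r ^+ 2 = 1 -> q ^+ 2 + q * s + s ^+ 2 = 1 ->
  2 * p * q + p * s + q * r + 2 * r * s = 1 ->
  a1 - a3 = b1 * p + b2 * r - b3 * (p + r) ->
  a2 - a3 = b1 * q + b2 * s - b3 * (q + s) ->
  sig3 a1 a2 a3 = sig3 b1 b2 b3 \/ sig3 a1 a2 a3 = - sig3 b1 b2 b3.
Proof.
rewrite /sig1 /sig3 => ha hb h1 h2 h3 l1 l2.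
have ea3 : a3 = - a1 - a2 by lra.
have eb3 : b3 = - b1 - b2 by lra.
subst a3 b3.
case: (hex_unit h1) => [] [] [? ?]; subst p r;
  case: (hex_unit h2) => [] [] [? ?]; subst q s => //.
all: clear h1 h2 h3 ha hb.
all: move: l1 l2; rewrite ?(mulr1, mulr0, mulrN1, addr0, add0r, subrr) => l1 l2.
all: first [have e1 : a1 = b1 by lia | have e1 : a1 = b2 by lia
  | have e1 : a1 = - b1 - b2 by lia | have e1 : a1 = - b1 by lia
  | have e1 : a1 = - b2 by lia | have e1 : a1 = b1 + b2 by lia].
all: first [have e2 : a2 = b1 by lia | have e2 : a2 = b2 by lia
  | have e2 : a2 = - b1 - b2 by lia | have e2 : a2 = - b1 by lia
  | have e2 : a2 = - b2 by lia | have e2 : a2 = b1 + b2 by lia].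
all: by rewrite e1 e2; first [by left; ring | by right; ring].
Qed.

(* When [sig1] vanishes the cubic factors as the linear form times
   [x ^+ 2 + x * y + y ^+ 2], so the change of basis is one of the twelve
   automorphisms of that quadratic form; these permute, up to a common sign,
   the three coordinates [x], [y] and [- (x + y)]. *)
Lemma triple_equiv_sum0_sig3 a1 a2 a3 b1 b2 b3 :
  triple_equiv a1 a2 a3 b1 b2 b3 -> sig1 a1 a2 a3 = 0 -> sig1 b1 b2 b3 = 0 ->
  sig2 a1 a2 a3 = sig2 b1 b2 b3 ->
  sig3 a1 a2 a3 = sig3 b1 b2 b3 \/ sig3 a1 a2 a3 = - sig3 b1 b2 b3.
Proof.
case/triple_equivE=> [p [q [r [s [_ [c0 c1 c2 c3] l1 l2]]]]] ha hb h2.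
have eb3 : b3 = - b1 - b2 by move: hb; rewrite /sig1; clear; lra.
set L1 := a1 - a3 in l1; set L2 := a2 - a3 in l2.
(* [n0], [n1], [n2] are the coefficients of x^2, x y, y^2 in the transformed quadratic form. The
   equations [u0] to [u3] say that its difference from x^2 + x y + y^2, multiplied by the linear
   form L1 x + L2 y, is zero. *)
set n0 := p ^+ 2 + p * r + r ^+ 2; set n2 := q ^+ 2 + q * s + s ^+ 2.
set n1 := 2 * p * q + p * s + q * r + 2 * r * s.
have u0 : L1 * (n0 - 1) = 0.
  transitivity (L1 * n0 - (a1 - a3)); first by rewrite /L1; ring.
  by rewrite c0 l1 /n0 eb3; ring.
have u3 : L2 * (n2 - 1) = 0.
  transitivity (L2 * n2 - (a2 - a3)); first by rewrite /L2; ring.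
  by rewrite c3 l2 /n2 eb3; ring.
have e3 : 3 * - a3 = L1 + L2 by move: ha; rewrite /L1 /L2 /sig1; clear; lra.
have u1 : L1 * (n1 - 1) + L2 * (n0 - 1) = 0.
  transitivity (L1 * n1 + L2 * n0 - (L1 + L2)); first by ring.
  by rewrite -e3 c1 l1 l2 /n1 /n0 eb3; ring.
have u2 : L1 * (n2 - 1) + L2 * (n1 - 1) = 0.
  transitivity (L1 * n2 + L2 * n1 - (L1 + L2)); first by ring.
  by rewrite -e3 c2 l1 l2 /n1 /n2 eb3; ring.
have [/andP[/eqP z1 /eqP z2]|nz] := boolP ((L1 == 0) && (L2 == 0)).
  have [za1 [za2 za3]] : a1 = 0 /\ a2 = 0 /\ a3 = 0.
    by move: z1 z2 ha; rewrite /L1 /L2 /sig1; clear; lia.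
  have [-> -> _] : [/\ b1 = 0, b2 = 0 & b3 = 0].
    apply: sqr_sum0; transitivity (sig1 b1 b2 b3 ^+ 2 - 2 * sig2 b1 b2 b3).
      by rewrite /sig1 /sig2; ring.
    by rewrite hb -h2 /sig2 za1 za2 za3; ring.
  by left; rewrite /sig3 za1 za2; ring.
(* A nonzero linear form can be cancelled from the product, one coefficient at a time. *)
have [m0 m1 m2] : [/\ n0 - 1 = 0, n1 - 1 = 0 & n2 - 1 = 0].
  move: (n0 - 1) (n1 - 1) (n2 - 1) u0 u1 u2 u3 nz => x y z.
  rewrite negb_and; clear => u0 u1 u2 u3 /orP[] nz.
    have x0 : x = 0 by move/eqP: u0; rewrite mulf_eq0 (negbTE nz) => /eqP.
    subst x; rewrite mulr0 addr0 in u1.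
    have y0 : y = 0 by move/eqP: u1; rewrite mulf_eq0 (negbTE nz) => /eqP.
    subst y; rewrite mulr0 addr0 in u2.
    by have z0 : z = 0 by move/eqP: u2; rewrite mulf_eq0 (negbTE nz) => /eqP.
  have z0 : z = 0 by move/eqP: u3; rewrite mulf_eq0 (negbTE nz) => /eqP.
  subst z; rewrite mulr0 add0r in u2.
  have y0 : y = 0 by move/eqP: u2; rewrite mulf_eq0 (negbTE nz) => /eqP.
  subst y; rewrite mulr0 add0r in u1.
  by have x0 : x = 0 by move/eqP: u1; rewrite mulf_eq0 (negbTE nz) => /eqP.
by apply: (@hex_aut_sig3 a1 a2 a3 b1 b2 b3 p q r s) => //;
  apply/eqP; rewrite -subr_eq0; apply/eqP.
Qed.

(** If e_1 is nonzero, the invariant e_1 e_3 yields e_3 with the sign that relates the two values of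
    e_1. If e_1 = 0, the sign is free on e_1 and comes from the automorphisms of the quadratic
    form. *)
Lemma triple_equiv_sig3 a1 a2 a3 b1 b2 b3 :
  triple_equiv a1 a2 a3 b1 b2 b3 ->
  sig1 a1 a2 a3 ^+ 2 = sig1 b1 b2 b3 ^+ 2 -> sig2 a1 a2 a3 = sig2 b1 b2 b3 ->
  exists e : bool, sig1 a1 a2 a3 = (-1) ^+ e * sig1 b1 b2 b3 /\
                   sig3 a1 a2 a3 = (-1) ^+ e * sig3 b1 b2 b3.
Proof.
move=> hE h1 h2; have [ht _ _] := triple_equiv_inv hE.
have [z|nz] := eqVneq (sig1 b1 b2 b3) 0.
  have z' : sig1 a1 a2 a3 = 0.
    by apply/eqP; move/eqP: h1; rewrite z expr0n /= sqrf_eq0.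
  case: (triple_equiv_sum0_sig3 hE z' z h2) => ->.
    by exists false; rewrite z z' !mul1r.
  by exists true; rewrite z z' expr1 mulr0 mulN1r.
move/eqP: h1; rewrite eqf_sqr => /orP[] /eqP h.
  by exists false; rewrite !mul1r; split=> //; apply: (mulfI nz); rewrite -ht h.
exists true; rewrite !mulN1r; split=> //; apply: (mulfI nz).
by rewrite mulrN -ht h mulNr opprK.
Qed.

(* [sig2 * sig1 ^+ 2] is a root of a quadratic polynomial whose coefficients
   are invariants, so it takes at most two values. *)
Lemma triple_equiv_pigeonhole a1 a2 a3 b1 b2 b3 c1 c2 c3 :
  triple_equiv a1 a2 a3 b1 b2 b3 -> triple_equiv b1 b2 b3 a1 a2 a3 ->
  triple_equiv c1 c2 c3 b1 b2 b3 ->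
  [\/ sig1 a1 a2 a3 ^+ 2 = sig1 b1 b2 b3 ^+ 2 /\ sig2 a1 a2 a3 = sig2 b1 b2 b3,
      sig1 c1 c2 c3 ^+ 2 = sig1 b1 b2 b3 ^+ 2 /\ sig2 c1 c2 c3 = sig2 b1 b2 b3
    | sig1 a1 a2 a3 ^+ 2 = sig1 c1 c2 c3 ^+ 2 /\ sig2 a1 a2 a3 = sig2 c1 c2 c3].
Proof.
move=> ab ba cb.
have [t1 s1 r1] := triple_equiv_inv ab; have [t2 s2 r2] := triple_equiv_inv cb.
have := sig_quadratic c1 c2 c3; have := sig_quadratic b1 b2 b3.
have := sig_quadratic a1 a2 a3; rewrite /= t1 s1 r1 t2 s2 r2.
(* Let X = e_2 e_1^2. From X^2 = e_2^2 (e_1^2)^2 one gets e_1^2, which is nonnegative; then e_2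
   follows by division, or from its sign when e_1 = 0. *)
have sameX : forall x1 x2 x3 y1 y2 y3 : int,
    sig2 x1 x2 x3 ^+ 2 = sig2 y1 y2 y3 ^+ 2 -> sig2 y1 y2 y3 != 0 ->
    sig2 x1 x2 x3 * sig1 x1 x2 x3 ^+ 2 = sig2 y1 y2 y3 * sig1 y1 y2 y3 ^+ 2 ->
    sig1 x1 x2 x3 ^+ 2 = sig1 y1 y2 y3 ^+ 2 /\ sig2 x1 x2 x3 = sig2 y1 y2 y3.
  move=> x1 x2 x3 y1 y2 y3 hs nz hX.
  have hE : sig1 x1 x2 x3 ^+ 2 = sig1 y1 y2 y3 ^+ 2.
    apply: sqr_inj; rewrite ?sqr_ge0 //.
    have nz2 : sig2 y1 y2 y3 ^+ 2 != 0 by rewrite sqrf_eq0.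
    by apply: (mulfI nz2); rewrite -{1}hs -!exprMn hX.
  split=> //; have [z|nz1] := eqVneq (sig1 y1 y2 y3) 0.
    have z' : sig1 x1 x2 x3 = 0.
      by apply/eqP; move/eqP: hE; rewrite z expr0n /= sqrf_eq0.
    have := sig1_eq0_sig2_le0 z; have := sig1_eq0_sig2_le0 z'.
    rewrite -oppr_ge0 => hx; rewrite -oppr_ge0 => hy.
    by apply: oppr_inj; apply: sqr_inj; rewrite ?sqrrN.
  have nz2 : sig1 y1 y2 y3 ^+ 2 != 0 by rewrite sqrf_eq0.
  by apply: (mulIf nz2); rewrite -{1}hE.
(* With e_2 = 0 the relation reads -4 t E^2 = constant and determines E, unless t = 0, where
   divisibility in both directions does. *)
have [z|nz] := eqVneq (sig2 b1 b2 b3) 0.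
  have za : sig2 a1 a2 a3 = 0 by apply/eqP; move/eqP: s1; rewrite z expr0n /= sqrf_eq0.
  rewrite z za !mul0r !mulr0 !addr0 expr0n /= sub0r => qa qb _; constructor 1; split=> //.
  have [zt|nzt] := eqVneq (sig1 b1 b2 b3 * sig3 b1 b2 b3) 0.
    have zta : sig1 a1 a2 a3 * sig3 a1 a2 a3 = 0 by rewrite t1.
    have d1 := triple_equiv_degenerate_dvd ab zta za zt z.
    have d2 := triple_equiv_degenerate_dvd ba zt z zta za.
    have : (`|sig1 a1 a2 a3| == `|sig1 b1 b2 b3|)%N by rewrite eqn_dvd -!dvdzE d1 d2.
    by move: (sig1 a1 a2 a3) (sig1 b1 b2 b3); clear => x y; nia.
  apply: sqr_inj; rewrite ?sqr_ge0 //.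
  have nz4 : - (4 * (sig1 b1 b2 b3 * sig3 b1 b2 b3)) != 0.
    by rewrite oppr_eq0 mulf_neq0.
  by apply: (mulfI nz4); rewrite qa -qb.
have nza : sig2 a1 a2 a3 != 0 by rewrite -sqrf_eq0 s1 sqrf_eq0.
have nzc : sig2 c1 c2 c3 != 0 by rewrite -sqrf_eq0 s2 sqrf_eq0.
set D := _ - 4 * _; set B := 18 * _ - _; move=> qa qb qc.
have [hab|nab] := eqVneq (sig2 a1 a2 a3 * sig1 a1 a2 a3 ^+ 2)
                         (sig2 b1 b2 b3 * sig1 b1 b2 b3 ^+ 2).
  by constructor 1; apply: sameX.
have [hcb|ncb] := eqVneq (sig2 c1 c2 c3 * sig1 c1 c2 c3 ^+ 2)
                         (sig2 b1 b2 b3 * sig1 b1 b2 b3 ^+ 2).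
  by constructor 2; apply: sameX.
have [hac|nac] := eqVneq (sig2 a1 a2 a3 * sig1 a1 a2 a3 ^+ 2)
                         (sig2 c1 c2 c3 * sig1 c1 c2 c3 ^+ 2).
  by constructor 3; apply: sameX => //; rewrite s1 s2.
(* Three distinct roots of D X^2 + B S X = C S force D = B = 0. Then S = 4 t and 18 t = 4 S, so S =
   0, against e_2 being nonzero. *)
exfalso.
set S := sig2 b1 b2 b3 ^+ 2 in s1 s2 *.
set C := 27 * _ + _ in qa qb qc.
set Xa := _ * _ in nab nac qa; set Xb := _ * _ in nab ncb qb.
set Xc := _ * _ in nac ncb qc.
have root (X E s : int) : s ^+ 2 = S -> X = s * E -> D * E ^+ 2 + B * X = C ->
    D * X ^+ 2 + B * S * X = C * S.
  by move=> hs -> <-; rewrite -hs; ring.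
have {}qa := root _ _ _ s1 erefl qa; have {}qc := root _ _ _ s2 erefl qc.
have {}qb := root _ _ _ erefl erefl qb.
have ab' : D * (Xa + Xb) + B * S = 0.
  have nz' : Xa - Xb != 0 by rewrite subr_eq0.
  apply: (mulfI nz'); rewrite mulr0; transitivity
    ((D * Xa ^+ 2 + B * S * Xa) - (D * Xb ^+ 2 + B * S * Xb)); first by ring.
  by rewrite qa qb subrr.
have cb' : D * (Xc + Xb) + B * S = 0.
  have nz' : Xc - Xb != 0 by rewrite subr_eq0.
  apply: (mulfI nz'); rewrite mulr0; transitivity
    ((D * Xc ^+ 2 + B * S * Xc) - (D * Xb ^+ 2 + B * S * Xb)); first by ring.
  by rewrite qc qb subrr.
have D0 : D = 0.
  have nz' : Xa - Xc != 0 by rewrite subr_eq0.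
  apply: (mulIf nz'); rewrite mul0r; transitivity
    ((D * (Xa + Xb) + B * S) - (D * (Xc + Xb) + B * S)); first by ring.
  by rewrite ab' cb' subrr.
have S0 : S != 0 by rewrite sqrf_eq0.
have B0 : B = 0 by apply: (mulIf S0); rewrite mul0r -ab' D0; ring.
move/eqP: S0; apply; move: D0 B0; rewrite /D /B -/S; clear => D0 B0; lra.
Qed.

(** Equal elementary symmetric functions give equal monic cubics, hence equal multisets of roots;
    the comparison is made over the rationals. The sign affects e_1 and e_3 but not e_2. *)
Lemma perm_eq_of_sig a1 a2 a3 b1 b2 b3 (e : bool) :
  sig1 a1 a2 a3 = (-1) ^+ e * sig1 b1 b2 b3 -> sig2 a1 a2 a3 = sig2 b1 b2 b3 ->
  sig3 a1 a2 a3 = (-1) ^+ e * sig3 b1 b2 b3 ->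
  perm_eq [:: a1; a2; a3] [seq (-1) ^+ e * x | x <- [:: b1; b2; b3]].
Proof.
move=> h1 h2 h3; apply: (@perm_map_inj _ _ (intr : int -> rat)); first exact: intr_inj.
apply: prod_XsubC_eq; rewrite !big_map -!map_prod_XsubC; congr map_poly.
rewrite /= !big_cons !big_nil.
have expand (x y z : int) : ('X - x%:P) * (('X - y%:P) * (('X - z%:P) * 1))
    = 'X^3 - (sig1 x y z)%:P * 'X^2 + (sig2 x y z)%:P * 'X - (sig3 x y z)%:P.
  by rewrite /sig1 /sig2 /sig3 !(polyCD, polyCM); ring.
have k1 : sig1 ((-1) ^+ e * b1) ((-1) ^+ e * b2) ((-1) ^+ e * b3)
    = (-1) ^+ e * sig1 b1 b2 b3 by rewrite /sig1; ring.
have k2 : sig2 ((-1) ^+ e * b1) ((-1) ^+ e * b2) ((-1) ^+ e * b3)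
    = sig2 b1 b2 b3 by case: (e); rewrite /sig2 ?expr1 ?expr0; ring.
have k3 : sig3 ((-1) ^+ e * b1) ((-1) ^+ e * b2) ((-1) ^+ e * b3)
    = (-1) ^+ e * sig3 b1 b2 b3 by case: (e); rewrite /sig3 ?expr1 ?expr0; ring.
by rewrite !expand h1 h2 h3 k1 k2 k3.
Qed.

(** * Reduced classes *)

Lemma graph_iso_sym G G' : graph_iso G G' -> graph_iso G' G.
Proof.
move=> [f [g [[f' fK f'K] [g' gK g'K] hE hl]]]; exists f', g'; split.
- by exists f.
- by exists g.
- by move=> u v; rewrite -hE f'K g'K.
- by move=> u; case: (hl (f' u)); rewrite f'K => -> -> ->.
Qed.

Lemma graph_iso_trans G1 G2 G3 :
  graph_iso G1 G2 -> graph_iso G2 G3 -> graph_iso G1 G3.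
Proof.
move=> [f [g [bf bg hE hl]]] [f' [g' [bf' bg' hE' hl']]].
exists (f' \o f), (g' \o g); split; try exact: bij_comp.
- by move=> u v; rewrite /= hE' hE.
- by move=> u; case: (hl u); case: (hl' (f u)) => /= -> -> ->.
Qed.

Definition edge_constant (G : plumbing_graph) (s : vertex G -> bool) : Prop :=
  forall u v, gE u v -> s (inl u) = s (inr v).

Lemma edge_constantP (G : plumbing_graph) (s : vertex G -> bool) :
  edge_constant s <-> (forall x y, connect (@adj G) x y -> s x = s y).
Proof.
split=> [hs x y /connectP[p hp ->] {y}|hs u v huv]; last first.
  by apply: hs; apply: connect1.
elim: p x hp => //= y p IH x /andP[hxy /IH <-].
by case: x y hxy => [u|v] [u'|v'] //= h; rewrite (hs _ _ h).
Qed.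

Lemma eq_reduced_class_sym G G' : eq_reduced_class G G' -> eq_reduced_class G' G.
Proof. by move=> h K; rewrite h. Qed.

Lemma eq_reduced_class_trans G1 G2 G3 :
  eq_reduced_class G1 G2 -> eq_reduced_class G2 G3 -> eq_reduced_class G1 G3.
Proof. by move=> h h' K; rewrite h h'. Qed.

Lemma graph_iso_eq_reduced_class G G' :
  graph_iso G G' -> eq_reduced_class G G'.
Proof.
suff imp H H' : graph_iso H H' -> forall K, reduced_class H K -> reduced_class H' K.
  by move=> hG K; split; apply: imp => //; apply: graph_iso_sym.
move=> [f [g [[f' fK f'K] [g' gK g'K] hE hl]]] K [hK [s [/edge_constantP hs hiso]]].
split=> //; exists (fun x => s (match x with inl u => inl (f' u) | inr v => inr (g' v) end)).
split.
  by apply/edge_constantP => u v huv; apply: hs; rewrite -hE f'K g'K.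
apply: graph_iso_trans hiso _; exists f, g; split; [by exists f'|by exists g'|by []|].
by move=> u; rewrite /= fK; case: (hl u) => -> -> ->.
Qed.

(** Sign changes compose by exclusive or, and each is its own inverse. *)
Lemma sign_change_eq_reduced_class (G : plumbing_graph) (s : vertex G -> bool) :
  edge_constant s -> eq_reduced_class (sign_change s) G.
Proof.
move=> hs K; split=> [] [hK [s' [/edge_constantP hs' hiso]]]; split=> //.
  exists (fun x => s x (+) s' x); split.
    by apply/edge_constantP => u v huv; rewrite (hs _ _ huv) (hs' _ _ huv).
  apply: graph_iso_trans hiso _; exists id, id; split=> //; try exact: inv_bij.
  by move=> u /=; case: (s (inl u)); case: (s' (inl u)); rewrite /= ?opprK.
exists (fun x => s x (+) s' x : bool); split.
  by apply/edge_constantP => u v huv; rewrite (hs _ _ huv) (hs' _ _ huv).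
apply: graph_iso_trans hiso _; exists id, id; split=> //; try exact: inv_bij.
by move=> u /=; case: (s (inl u)); case: (s' (inl u)); rewrite /= ?opprK.
Qed.

Lemma pair_eq_reduced_class (a1 a2 b1 b2 : int) (e : bool) :
  perm_eq [:: a1; a2] [seq (-1) ^+ e * x | x <- [:: b1; b2]] ->
  eq_reduced_class (disjoint_union (isolated_vertex a1 0 0) (isolated_vertex a2 0 0))
                   (disjoint_union (isolated_vertex b1 0 0) (isolated_vertex b2 0 0)).
Proof.
move=> hp; set H := disjoint_union (isolated_vertex b1 _ _) _.
apply: eq_reduced_class_trans (@sign_change_eq_reduced_class H (fun _ => e) _);
  last by case.
apply: graph_iso_eq_reduced_class.
have sgn (b : int) : (-1) ^+ e * b = if e then - b else b.
  by case: (e); rewrite ?mulN1r ?mul1r.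
(* The two labels agree in order or after a swap; the swap is realised by exchanging the two
   vertices. *)
have [[h1 h2]|[h1 h2]] : (a1 = (-1) ^+ e * b1 /\ a2 = (-1) ^+ e * b2)
    \/ (a1 = (-1) ^+ e * b2 /\ a2 = (-1) ^+ e * b1).
  have : a1 \in [seq (-1) ^+ e * x | x <- [:: b1; b2]].
    by rewrite -(perm_mem hp) mem_head.
  rewrite /= !inE => /orP[] /eqP h; [left|right]; split=> //; move: hp.
    by rewrite /= h perm_cons => /perm_consP[[|i] [u [//= + /perm_nilP hu]]]; rewrite hu; case.
  rewrite /= h -[X in perm_eq _ X]/([:: _] ++ [:: _]) perm_sym perm_catC /= perm_cons.
  by move=> /perm_consP[[|i] [u [//= + /perm_nilP hu]]]; rewrite hu; case.
- exists id, id; split=> //; try exact: inv_bij.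
  by case=> -[] /=; rewrite ?h1 ?h2 !sgn; case: (e).
- exists (fun u => match u with inl _ => inr tt | inr _ => inl tt end),
    (fun v => match v with inl v => inr v | inr v => inl v end).
  split; [by exists (fun u => match u with inl _ => inr tt | inr _ => inl tt end) => -[[]|[]]
         |by exists (fun v => match v with inl v => inr v | inr v => inl v end) => -[]
         |by move=> u; case=> -[]|].
  by case=> -[] /=; rewrite ?h1 ?h2 !sgn; case: (e).
Qed.

Lemma star3_eq_reduced_class (a b : 'I_3 -> int) (e : bool) :
  perm_eq [:: a ord0; a (inord 1); a ord_max]
          [seq (-1) ^+ e * x | x <- [:: b ord0; b (inord 1); b ord_max]] ->
  eq_reduced_class (star3 a) (star3 b).
Proof.
move=> hp.
apply: eq_reduced_class_trans (@sign_change_eq_reduced_class (star3 b) (fun _ => e) _);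
  last by case.
apply: graph_iso_eq_reduced_class.
have sgn (x : int) : (-1) ^+ e * x = if e then - x else x.
  by case: (e); rewrite ?mulN1r ?mul1r.
have enum3 (c : 'I_3 -> int) :
    [tuple c i | i < 3] = [:: c ord0; c (inord 1); c ord_max] :> seq int.
  apply: (@eq_from_nth _ 0); rewrite ?size_tuple //= => -[|[|[|i]]] // hi;
    rewrite -[LHS]/(nth 0 [tuple c i | i < 3] _) -(tnth_nth 0 _ (Ordinal hi)) tnth_mktuple /=;
    by congr c; apply: val_inj; rewrite /= ?inordK.
have /tuple_permP[p hpE] : perm_eq [tuple a i | i < 3] [tuple (-1) ^+ e * b i | i < 3].
  by rewrite (enum3 a) (enum3 (fun i => (-1) ^+ e * b i)).
exists p, id; split=> //; try exact: inv_bij; first by apply: injF_bij; exact: perm_inj.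
move=> i /=; have : tnth [tuple a i | i < 3] i = (-1) ^+ e * b (p i).
  rewrite (val_inj hpE : [tuple a i | i < 3] = [tuple _ | i < 3]).
  by rewrite !tnth_mktuple.
by rewrite tnth_mktuple => ->; rewrite sgn; case: (e).
Qed.

Lemma theta_pair_eq_reduced_class (a b : int) : `|a| = `|b| ->
  eq_reduced_class (disjoint_union Theta (isolated_vertex a 0 0))
                   (disjoint_union Theta (isolated_vertex b 0 0)).
Proof.
move=> hab; set H := disjoint_union _ (isolated_vertex b _ _).
(* Only the isolated vertex changes sign, so that the label (0; 1, 0) of [Theta] stays. *)
pose s (x : vertex H) := if x is inl (inr _) then a != b else false.
apply: eq_reduced_class_trans (@sign_change_eq_reduced_class H s _);
  last by case=> [?|?] [?|?].
apply: graph_iso_eq_reduced_class; exists id, id; split=> //; try exact: inv_bij.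
case=> -[] //=; case: eqVneq => [->|nab] //=; split=> //.
by move/eqP: hab; rewrite eqr_norm2 (negbTE nab) /= => /eqP ->.
Qed.

Lemma isolated_opp_eq_reduced_class (a : int) (p m : nat) :
  eq_reduced_class (isolated_vertex a p m) (isolated_vertex (- a) m p).
Proof.
apply: eq_reduced_class_trans
  (@sign_change_eq_reduced_class (isolated_vertex (- a) m p) (fun _ => true) _); last by case.
apply: graph_iso_eq_reduced_class; exists id, id; split=> //; try exact: inv_bij.
by case; rewrite /= opprK.
Qed.

(** * Forests *)

(** Without a leaf, every simple path in S extends at its front to a longer one: the first vertex
    has a neighbour other than the next vertex, and meeting the path again would close a cycle.
    Arbitrarily long simple paths contradict finiteness. *)
Lemma forest_has_leaf (T : finType) (e : rel T) (S : {set T}) :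
  symmetric e -> irreflexive e ->
  (forall c : seq T, ucycle e c -> (size c <= 2)%N) ->
  S != set0 -> exists2 x, x \in S & (#|[set y in S | e x y]| <= 1)%N.
Proof.
move=> esym eirr acyc /set0Pn[x0 x0S]; apply/exists_inP; apply: contraT.
rewrite negb_exists_in => /forall_inP no_leaf; exfalso.
have long n : exists x p, [/\ path e x p, uniq (x :: p),
    {subset x :: p <= S} & size p = n].
  elim: n => [|n [x [p [hp up pS sz]]]].
    by exists x0, [::]; split=> // y; rewrite inE => /eqP ->.
  have xS : x \in S by apply: pS; rewrite mem_head.
  (* For empty p the default [x] of [head] makes the condition y != x, which irreflexivity grants
     anyway. *)
  have [y yS /andP[exy yp]] : exists2 y, y \in S & e x y && (y != head x p).
    have := no_leaf _ xS; rewrite -ltnNge => /card_gt1P[y1 [y2 [+ + neq]]].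
    rewrite !inE => /andP[y1S e1] /andP[y2S e2].
    have [h|h] := eqVneq y1 (head x p); last by exists y1; rewrite ?e1.
    by exists y2; rewrite ?e2 // -h eq_sym.
  have xy : y != x by apply: contraTneq exy => ->; rewrite eirr.
  have [yp'|ynp] := boolP (y \in p); last first.
    exists y, (x :: p); split=> //=.
    - by rewrite esym exy.
    - by rewrite inE negb_or xy ynp; exact: up.
    - by move=> z; rewrite inE => /orP[/eqP ->|/pS].
    - by rewrite sz.
  case/splitPr: yp' hp up yp => p1 p2.
  (* Since y is not the head of p, the part before y is nonempty and the closed walk has at least
     three vertices. *)
  case: p1 => [|z p1] hp; first by rewrite /= eqxx.
  rewrite -cat_rcons -cat_cons cat_uniq => /andP[up _] _.
  move: hp; rewrite -cat_rcons cat_path => /andP[hp _].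
  have := acyc (x :: rcons (z :: p1) y); rewrite /ucycle up /cycle rcons_path hp.
  by rewrite last_rcons esym exy => /(_ isT); rewrite /= size_rcons.
have [x [p [_ up _ sz]]] := long #|T|.
by have := card_uniqP up; have := max_card (mem (x :: p)) => /= + h; rewrite h /= sz ltnn.
Qed.

(** The degree sum counts each edge twice, so this says that there are fewer edges than vertices.
    Induction over subsets S removes a leaf, which costs one vertex and at most one edge. *)
Lemma forest_degree_sum (T : finType) (e : rel T) :
  symmetric e -> irreflexive e ->
  (forall c : seq T, ucycle e c -> (size c <= 2)%N) -> (0 < #|T|)%N ->
  ((\sum_x #|[pred y | e x y]|).+2 <= 2 * #|T|)%N.
Proof.
move=> esym eirr acyc T0.
suff main (S : {set T}) : S != set0 ->
    ((\sum_(x in S) #|[set y in S | e x y]|).+2 <= 2 * #|S|)%N.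
  have := main setT; rewrite -card_gt0 cardsT => /(_ T0); congr (_.+2 <= _)%N.
  apply: eq_big => [x|x _]; first by rewrite inE.
  by apply: eq_card => y; rewrite !inE.
have [n] := ubnP #|S|; elim: n S => // n IH S /ltnSE leSn S0.
have [x xS leaf] := forest_has_leaf esym eirr acyc S0.
rewrite (big_setD1 x xS) /=.
(* Deleting x lowers the degree of each of its neighbours by one, in total by the degree of x. *)
have -> : (\sum_(z in S :\ x) #|[set y in S | e z y]| =
    \sum_(z in S :\ x) #|[set y in S :\ x | e z y]| + #|[set y in S | e x y]|)%N.
  have -> : #|[set y in S | e x y]| = (\sum_(z in S :\ x) (e x z : nat))%N.
    rewrite -sum1_card big_mkcond [RHS]big_mkcond; apply: eq_bigr => z _.
    by rewrite !inE; case: eqVneq => [->|]; rewrite ?eirr ?andbF //=;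
      case: (z \in S); case: (e x z).
  rewrite -big_split; apply: eq_bigr => z _ /=.
  rewrite -[LHS](cardsID [set x]) addnC; congr (_ + _)%N.
    by apply: eq_card => y; rewrite !inE andbA.
  rewrite esym; case exz: (e z x).
    apply/eqP/cards1P; exists x; apply/setP => y; rewrite !inE.
    by case: eqVneq => [->|]; rewrite ?andbF // xS exz.
  apply: eq_card0 => y; rewrite !inE; case: eqVneq => [->|]; rewrite ?andbF //.
  by rewrite exz andbF.
have cS : #|S| = #|S :\ x|.+1 by rewrite (cardsD1 x) xS.
have [z|nz] := eqVneq (S :\ x) set0.
  rewrite z big_set0 cS z cards0.
  have -> : #|[set y in S | e x y]| = 0%N; last by [].
  apply: eq_card0 => y; rewrite !inE; apply/negP => /andP[yS exy].
  have : y \in S :\ x by rewrite !inE yS andbT; apply: contraTneq exy => ->; rewrite eirr.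
  by rewrite z inE.
have := IH (S :\ x) _ nz; rewrite cS in leSn *; move/(_ leSn).
by move: leaf; clear; lia.
Qed.

(** * The rank bound *)

Lemma adj_sym (G : plumbing_graph) : symmetric (@adj G).
Proof. by case=> [u|v] [u'|v']. Qed.

Lemma adj_irrefl (G : plumbing_graph) : irreflexive (@adj G).
Proof. by case. Qed.

(** A cycle stays in the component of its first vertex, so it lifts to that component. *)
Lemma acyclic_of_components (G : plumbing_graph) :
  (forall x : vertex G, acyclic (component x)) -> acyclic G.
Proof.
move=> acyc [|x p] // /andP[hc hu].
pose emb (y : vertex (component x)) : vertex G :=
  match y with inl u => inl (val u) | inr v => inr (val v) end.
have emb_surj y : connect (@adj G) x y -> exists y', emb y' = y.
  by case: y => z hz; [exists (inl (exist _ z hz))|exists (inr (exist _ z hz))].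
have lift (c : seq (vertex G)) : {subset c <= connect (@adj G) x} ->
    exists c', map emb c' = c.
  elim: c => [|y c IH] hsub; first by exists [::].
  have [y' <-] : exists y', emb y' = y by apply: emb_surj; apply: hsub; rewrite mem_head.
  have [|c' <-] := IH; first by move=> z hz; apply: hsub; rewrite inE hz orbT.
  by exists (y' :: c').
have [c' hc'] : exists c', map emb c' = x :: p.
  apply: lift => y hy; apply: (path_connect hc).
  by rewrite inE mem_rcons orbA orbb -in_cons.
have {}hc : cycle (@adj G) (map emb c') by rewrite hc'.
rewrite -hc' size_map; apply: (acyc x); apply/andP; split; last first.
  by move: hu; rewrite -hc' => /map_uniq.
case: (c') hc => [//|x' p']; rewrite /= -map_rcons path_map.
by rewrite (@eq_path _ _ (@adj (component x))) // => -[u|v] [u'|v'].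
Qed.

Lemma sum_degU_degV (G : plumbing_graph) :
  (\sum_(u : gU G) degU u = \sum_(v : gV G) degV v)%N.
Proof.
have eU (u : gU G) : degU u = (\sum_v (gE u v : nat))%N.
  by rewrite /degU -sum1_card big_mkcond; apply: eq_bigr => v _; rewrite inE; case: gE.
have eV (v : gV G) : degV v = (\sum_u (gE u v : nat))%N.
  by rewrite /degV -sum1_card big_mkcond; apply: eq_bigr => u _; rewrite inE; case: gE.
by rewrite (eq_bigr _ (fun u _ => eU u)) (eq_bigr _ (fun v _ => eV v)) exchange_big.
Qed.

Lemma acyclic_sum_degV (G : plumbing_graph) : acyclic G ->
  (0 < #|gU G| + #|gV G|)%N -> ((\sum_(v : gV G) degV v).+1 <= #|gU G| + #|gV G|)%N.
Proof.
move=> acyc G0.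
have cardE : #|vertex G| = (#|gU G| + #|gV G|)%N by rewrite card_sum.
have := forest_degree_sum (@adj_sym G) (@adj_irrefl G) acyc.
rewrite cardE => /(_ G0); rewrite big_sumType /=.
have -> : (\sum_(u : gU G) #|[pred y | adj (inl u) y]| = \sum_(u : gU G) degU u)%N.
  apply: eq_bigr => u _; rewrite /degU -(card_imset _ (@inr_inj (gU G) (gV G))).
  apply: eq_card => -[u'|v]; rewrite !inE /=; last by rewrite mem_imset ?inE //; exact: inr_inj.
  by symmetry; apply/imsetP => -[].
have -> : (\sum_(v : gV G) #|[pred y | adj (inr v) y]| = \sum_(v : gV G) degV v)%N.
  apply: eq_bigr => v _; rewrite /degV -(card_imset _ (@inl_inj (gU G) (gV G))).
  apply: eq_card => -[u|v']; rewrite !inE /=; first by rewrite mem_imset ?inE //; exact: inl_inj.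
  by symmetry; apply/imsetP => -[].
by rewrite sum_degU_degV; clear; lia.
Qed.

Lemma card_symb (G : plumbing_graph) :
  #|symb G| = (#|gU G| + \sum_(u : gU G) (gkm u + gkp u))%N.
Proof.
rewrite card_tagged sumnE big_map big_enum /= -sum1_card -big_split.
by apply: eq_bigr => u _; rewrite card_ord.
Qed.

Definition coef (G : plumbing_graph) (s : symb G) (x : lattH G) : int := valH x s.

Lemma coef_zmod_morphism (G : plumbing_graph) (s : symb G) :
  zmod_morphism (coef s).
Proof. by move=> x y; rewrite /coef !ffunE. Qed.

HB.instance Definition _ (G : plumbing_graph) (s : symb G) :=
  GRing.isZmodMorphism.Build (lattH G) int (coef s) (coef_zmod_morphism s).

Lemma lattH_eq (G : plumbing_graph) (x y : lattH G) :
  (forall s, coef s x = coef s y) -> x = y.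
Proof. by move=> h; apply: val_inj; apply/ffunP => s; apply: h. Qed.

Lemma coef_inH (G : plumbing_graph) (x : lattH G) (v : gV G) :
  \sum_(u : gU G | gE u v) coef (symb0 u) x = 0.
Proof. by have /forallP/(_ v)/eqP := valP x. Qed.

(** For a basis b_0, b_1 the element f(b_1) b_0 - f(b_0) b_1 is killed by f, hence zero.
    Independence gives f(b_0) = 0, so b_0 = 0, which is absurd. *)
Lemma free_of_rank2_not_embed_int (M : zmodType) (f : {additive M -> int}) :
  free_of_rank M 2 -> ~ injective f.
Proof.
move=> [b hb] finj.
pose c (i j : int) : {ffun 'I_2 -> int} := [ffun k => if k == ord0 then i else j].
have cE i j : \sum_(k < 2) b k *~ c i j k = b ord0 *~ i + b ord_max *~ j.
  by rewrite big_ord_recl big_ord1 !ffunE /=; congr (_ + b _ *~ _); apply: val_inj.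
have uniq0 i j : b ord0 *~ i + b ord_max *~ j = 0 -> i = 0 /\ j = 0.
  move=> h; have [c0 [_ c0u]] := hb 0.
  have h1 := c0u (c i j); rewrite cE h in h1.
  have h2 := c0u (c 0 0); rewrite cE !mulr0z addr0 in h2.
  have /ffunP e : c i j = c 0 0 by rewrite -h1 // -h2.
  by have := e ord0; have := e ord_max; rewrite !ffunE.
have [h0 h1] : f (b ord_max) = 0 /\ - f (b ord0) = 0.
  apply: uniq0; apply: finj; rewrite raddfD !raddfMz raddf0 /= !mulrzz; ring.
have b0 : b ord0 = 0 by apply: finj; rewrite raddf0; apply: oppr_inj; rewrite h1 oppr0.
by have [] // := uniq0 1 0; rewrite b0 mul0rz mulr0z addr0.
Qed.

(** Used to exclude the small graphs whose lattice has rank at most 1. *)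
Lemma rank2_not_determined (G : plumbing_graph) (s : symb G) :
  has_rank G 2 -> ~ (forall x : lattH G, coef s x = 0 -> x = 0).
Proof.
move=> hr h; apply: (@free_of_rank2_not_embed_int _ (coef s) hr).
by apply: raddf_inj.
Qed.

(** Over the rationals the lattice becomes the kernel of the matrix [M] of vertex equations, of
    dimension at least the number of symbols minus the number of equations. A rational kernel vector
    is a multiple of an integral one, so the two basis rows of [B] span the kernel. *)
Lemma rank2_card_symb (G : plumbing_graph) :
  has_rank G 2 -> (#|symb G| <= #|gV G| + 2)%N.
Proof.
move=> [b hb].
pose M : 'M[rat]_(#|symb G|, #|gV G|) :=
  \matrix_(i, j) \sum_(u : gU G | gE u (enum_val j)) (enum_val i == symb0 u)%:R.
pose B : 'M[rat]_(2, #|symb G|) := \matrix_(k, i) (coef (enum_val i) (b k))%:~R.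
have kerB : (kermx M <= B)%MS.
  apply/row_subP => i0; set r := row i0 (kermx M).
  have rM : r *m M = 0 by apply/sub_kermxP; exact: row_sub.
  (* Clearing denominators: [z] is d times the row r, computed inside the integers. *)
  pose d : int := \prod_j denq (r 0 j).
  pose z j : int := numq (r 0 j) * \prod_(l | l != j) denq (r 0 l).
  have dnz : d%:~R != 0 :> rat by rewrite intr_eq0; apply/prodf_neq0 => j _; apply: denq_neq0.
  have zE j : (z j)%:~R = d%:~R * r 0 j.
    have q0 : (denq (r 0 j))%:~R != 0 :> rat by rewrite intr_eq0 denq_neq0.
    rewrite /d (bigD1 j) //= /z !rmorphM /= numqE; ring.
  pose x : lattA G := [ffun s => z (enum_rank s)].
  have xH : x \in @inH G.
    apply/forallP => v; rewrite -(@intr_eq0 rat); apply/eqP.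
    transitivity (d%:~R * (r *m M) 0 (enum_rank v)); last by rewrite rM mxE mulr0.
    rewrite mxE mulr_sumr rmorph_sum /=.
    under [RHS]eq_bigr => j _ do rewrite mulrA -zE mxE enum_rankK mulr_sumr.
    rewrite exchange_big /=; apply: eq_bigr => u _.
    rewrite (bigD1 (enum_rank (symb0 u))) //= enum_rankK eqxx mulr1 ffunE.
    rewrite big1 ?addr0 // => j hj; case: eqP => [h|_]; last by rewrite mulr0.
    by rewrite -h enum_valK eqxx in hj.
  have [c [xE _]] := hb (LattH xH).
  have -> : r = d%:~R^-1 *: \sum_k (c k)%:~R *: row k B.
    apply/rowP => j; rewrite [RHS]mxE summxE; apply: (mulfI dnz); rewrite mulVKf // -zE.
    have -> : z j = coef (enum_val j) (LattH xH) by rewrite /coef ffunE enum_valK.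
    rewrite xE raddf_sum rmorph_sum; apply: eq_bigr => k _.
    by rewrite raddfMz !mxE /= mulrzz intrM mulrC.
  by apply/scalemx_sub/summx_sub => k _; apply/scalemx_sub/row_sub.
have := leq_trans (mxrankS kerB) (rank_leq_row B).
rewrite mxrank_ker; have := rank_leq_col M; clear; lia.
Qed.

(** * Reduced graphs of rank 2 *)

(** The four shapes name vertices inside G, because both the isomorphism with a standard graph and
    the coordinates on [lattH G] are read off from such names. *)
Record is_pair (G : plumbing_graph) (u1 u2 : gU G) : Prop := IsPair {
  pair_neq : u1 != u2;
  pair_U : forall u, u \in [:: u1; u2];
  pair_V : gV G -> False;
  pair_spin : spin G }.

Record is_star (G : plumbing_graph) (u1 u2 u3 : gU G) (v : gV G) : Prop := IsStar {
  star_uniq : uniq [:: u1; u2; u3];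
  star_U : forall u, u \in [:: u1; u2; u3];
  star_V : forall v', v' = v;
  star_E : forall u, gE u v;
  star_spin : spin G;
  star_alpha : forall u : gU G, galpha u <> 0 }.

Record is_theta_pair (G : plumbing_graph) (u0 u1 : gU G) (v : gV G) : Prop :=
  IsThetaPair {
  tpair_neq : u0 != u1;
  tpair_U : forall u, u \in [:: u0; u1];
  tpair_V : forall v', v' = v;
  tpair_E0 : gE u0 v;
  tpair_E1 : gE u1 v = false;
  tpair_alpha : galpha u0 = 0;
  tpair_kp : gkp u0 = 1%N;
  tpair_km : gkm u0 = 0%N;
  tpair_kp1 : gkp u1 = 0%N;
  tpair_km1 : gkm u1 = 0%N }.

Record is_single (G : plumbing_graph) (u : gU G) : Prop := IsSingle {
  single_U : forall u', u' = u;
  single_V : gV G -> False;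
  single_k : (gkp u = 1 /\ gkm u = 0)%N \/ (gkp u = 0 /\ gkm u = 1)%N }.

Lemma card1_all_eq (T : finType) : #|T| = 1%N -> forall x y : T, x = y.
Proof.
move=> T1 x y; have /card_le1_eqP : (#|T| <= 1)%N by rewrite T1.
by apply.
Qed.

Lemma rank2_card_U (G : plumbing_graph) : has_rank G 2 -> (0 < #|gU G|)%N.
Proof.
move=> hr; rewrite lt0n; apply/eqP => U0.
apply: (@free_of_rank2_not_embed_int _ (\0 : {additive lattH G -> int}) hr).
move=> x y _; apply: lattH_eq => -[u i].
by have := fintype0 u U0.
Qed.

(** The non-spin conclusion feeds the second clause of [reduced], which then rules out a second copy
    of [Theta]. *)
Lemma component_Theta (G : plumbing_graph) (v : gV G) :
  graph_iso (@component G (inr v)) Theta -> exists u0 : gU G,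
  [/\ [/\ gE u0 v, forall u, gE u v -> u = u0 & forall v', gE u0 v' -> v' = v],
      forall v', connect (@adj G) (inr v) (inr v') -> v' = v,
      [/\ galpha u0 = 0, gkp u0 = 1%N & gkm u0 = 0%N]
    & ~ spin (@component G (inr v))].
Proof.
move=> [f [g [[f' fK f'K] [g' gK g'K] hE hl]]].
have finj : injective f := can_inj fK. have ginj : injective g := can_inj gK.
have cvv : connect (@adj G) (inr v) (inr v) by exact: connect0.
pose v0 : gV (@component G (inr v)) := exist _ v cvv.
pose u0 := f' tt; exists (val u0).
have Eu : gE (val u0) v by have := hE u0 v0.
have onlyV v' : connect (@adj G) (inr v) (inr v') -> v' = v.
  move=> h; pose v1 : gV (@component G (inr v)) := exist _ v' h.
  by have /(congr1 val) : v1 = v0 by apply: ginj; case: (g v1); case: (g v0).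
split=> //.
- split=> // [u hu|v' hv'].
    have cu : connect (@adj G) (inr v) (inl u) by apply: connect1.
    pose u1 : gU (@component G (inr v)) := exist _ u cu.
    by have /(congr1 val) : u1 = u0 by apply: finj; case: (f u1); case: (f u0).
  apply: onlyV; apply: (connect_trans (y := inl (val u0))); exact: connect1.
- by have [/= <- <- <-] := hl u0.
- by move/(_ u0) => []; have [_ /= <- _] := hl u0.
Qed.

(** Let K be the number of symbols of nonzero index. Then 3 |V| < |U| + |V| and |U| + K <= |V| + 2
    give |V| + K <= 1. For |V| = 0 there remain a spin pair or a single vertex; for |V| = 1, K = 0
    and |U| = 3. *)
Lemma reduced_rank2_no_Theta (G : plumbing_graph) :
  reduced G -> has_rank G 2 -> (forall v : gV G, (3 <= degV v)%N) ->
  [\/ exists u1 u2 : gU G, is_pair u1 u2,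
      exists (u1 u2 u3 : gU G) (v : gV G), is_star u1 u2 u3 v
    | exists u : gU G, is_single u].
Proof.
move=> [hac _ _ h0] hr hdeg.
have U0 := rank2_card_U hr; have hrk := rank2_card_symb hr.
rewrite card_symb in hrk.
have hE : ((\sum_(v : gV G) degV v).+1 <= #|gU G| + #|gV G|)%N.
  by apply: acyclic_sum_degV; [exact: acyclic_of_components|rewrite addn_gt0 U0].
have h3 : (3 * #|gV G| <= \sum_(v : gV G) degV v)%N.
  by rewrite mulnC -sum_nat_const; apply: leq_sum => v _; apply: hdeg.
set K := (\sum_(u : gU G) _)%N in hrk.
have spinK : K = 0%N -> spin G.
  move/eqP; rewrite sum_nat_eq0 => /forallP hK u; have := hK u.
  by rewrite /= addn_eq0 => /andP[/eqP -> /eqP ->].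
have [V0|V1] : #|gV G| = 0%N \/ #|gV G| = 1%N by lia.
  have noV : gV G -> False by move=> v; have := fintype0 v V0.
  have : #|gU G| = size (enum (gU G)) by rewrite cardE.
  have := mem_enum (gU G); have := enum_uniq (gU G).
  case: (enum (gU G)) => [|u1 [|u2 [|u3 s]]].
  - by move=> _ _ cU; rewrite cU in U0.
  - move=> _ hmem cU; constructor 3; exists u1.
    have U1 u' : u' = u1 by have := hmem u'; rewrite [RHS]inE inE => /eqP.
    have KE : K = (gkm u1 + gkp u1)%N.
      by rewrite /K (bigD1 u1) //= big1 ?addn0 // => u; rewrite (U1 u) eqxx.
    (* With K = 0 there would be a single symbol, and one coefficient would determine everything. *)
    split=> //; suff : K <> 0%N by lia.
    move=> K0; apply: (rank2_not_determined (s := symb0 u1) hr) => x hx.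
    apply: lattH_eq => s; rewrite raddf0 -hx; congr (coef _ x).
    have [k1 k2] := spinK K0 u1.
    case: s => u i; have eu := U1 u; subst u; rewrite /symb0; congr Tagged.
    by apply: val_inj => /=; case: i => i /=; lia.
  - rewrite /= inE andbT => u12 hmem cU; constructor 1; exists u1, u2; split=> //.
    by apply: spinK; move: hrk; rewrite cU V0; case: (K).
  - by move=> _ _ cU; exfalso; move: hrk; rewrite cU V0.
have hsp : spin G by apply: spinK; lia.
have [v Vv] : exists v : gV G, forall v', v' = v.
  have /card_gt0P[v _] : (0 < #|gV G|)%N by rewrite V1.
  by exists v => v'; apply: (@card1_all_eq _ V1).
have cU : #|gU G| = 3.
  have := max_card [set u | gE u v]; have := hdeg v; rewrite /degV; lia.
have hEv u : gE u v.
  have : u \in [set u | gE u v]; last by rewrite inE.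
  suff -> : [set u | gE u v] = setT by rewrite inE.
  by apply/eqP; rewrite eqEcard subsetT cardsT cU hdeg.
constructor 2; move: cU; rewrite cardE.
have := mem_enum (gU G); have := enum_uniq (gU G).
case: (enum (gU G)) => [|u1 [|u2 [|u3 [|u4 s]]]] // u123 hmem _.
exists u1, u2, u3, v; split=> // u a0.
have [k1 k2] := hsp u.
(* A leaf of the star has degree exactly 1, which [reduced] forbids for the label (0; 0, 0). *)
have d1 : (degU u <= 1)%N by rewrite -V1 /degU max_card.
have d0 : (0 < degU u)%N by apply/card_gt0P; exists v; rewrite inE hEv.
by case: (h0 u a0 k1 k2); move: d1 d0; clear; lia.
Qed.

(** Here v has degree at least 1, the other vertices of V at least 3, and K >= 1 because of u0. The
    same count gives |U| <= |V| + 1 and |V| <= 2. *)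
Lemma reduced_rank2_Theta (G : plumbing_graph) (v : gV G) :
  reduced G -> has_rank G 2 -> graph_iso (@component G (inr v)) Theta ->
  exists u0 u1 : gU G, is_theta_pair u0 u1 v.
Proof.
move=> [hac hTh hdeg h0] hr hv.
have [u0 [[E0 Ev Eu] onlyV [a0 p0 m0] nsp]] := component_Theta hv.
have hdeg' v' : v' != v -> (3 <= degV v')%N.
  move=> nv; apply: hdeg => hv'.
  have [_ [_ _ _ nsp']] := component_Theta hv'.
  have /onlyV e := hTh _ hv _ nsp'; by rewrite e eqxx in nv.
have U0 := rank2_card_U hr; have hrk := rank2_card_symb hr.
rewrite card_symb in hrk.
have hE : ((\sum_(v : gV G) degV v).+1 <= #|gU G| + #|gV G|)%N.
  by apply: acyclic_sum_degV; [exact: acyclic_of_components|rewrite addn_gt0 U0].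
have h3 : (1 + 3 * #|gV G|.-1 <= \sum_(v : gV G) degV v)%N.
  rewrite (bigD1 v) //=; apply: leq_add.
    by apply/card_gt0P; exists u0; rewrite inE.
  by rewrite -(cardC1 v) mulnC -sum_nat_const; apply: leq_sum => v' nv; apply: hdeg'.
set K := (\sum_(u : gU G) _)%N in hrk.
have K1 : K = (1 + \sum_(u | u != u0) (gkm u + gkp u))%N.
  by rewrite /K (bigD1 u0) //= p0 m0.
have V0 : (0 < #|gV G|)%N by apply/card_gt0P; exists v.
have V1 : #|gV G| = 1%N.
  (* A second v' has three neighbours, all different from u0, so |U| >= 4, contradicting |U| <=
     3. *)
  apply/eqP; rewrite eqn_leq V0 andbT leqNgt; apply/negP => V2.
  have [v' nv] : exists v', v' != v.
    have /card_gt0P[v'] : (0 < #|predC1 v|)%N by rewrite cardC1; lia.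
    by rewrite inE; exists v'.
  have := hdeg' _ nv; have : (degV v' < #|gU G|)%N.
    rewrite /degV -cardsT; apply: proper_card; rewrite properT.
    apply/eqP => /setP/(_ u0); rewrite !inE => /Eu e; by rewrite e eqxx in nv.
  by lia.
have Vv v' : v' = v by apply: (@card1_all_eq _ V1).
have U2 : #|gU G| = 2.
  (* If u0 were alone, its index-0 coefficient would vanish by the equation at v, leaving a single
     coordinate. *)
  suff : #|gU G| <> 1%N by lia.
  move=> U1; have Uu u : u = u0 by apply: (@card1_all_eq _ U1).
  have h1 : (1 < (gkm u0 + gkp u0).+1)%N by rewrite p0 m0.
  pose s1 : symb G := Tagged (fun u : gU G => 'I_(gkm u + gkp u).+1) (Ordinal h1).
  apply: (rank2_not_determined (s := s1) hr) => x hx; apply: lattH_eq.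
  case=> u i; have eu := Uu u; subst u; rewrite raddf0.
  have x0 : coef (symb0 u0) x = 0.
    have := coef_inH x v; rewrite (bigD1 u0) //= big1 ?addr0 // => u /andP[_].
    by rewrite (Uu u) eqxx.
  have [i0|i1] : val i = 0%N \/ val i = 1%N by case: i => i /=; lia.
    by rewrite -[RHS]x0; congr (coef (Tagged _ _) x); apply: val_inj; rewrite [LHS]i0 /= m0.
  by rewrite -[RHS]hx; congr (coef (Tagged _ _) x); apply: val_inj.
have [u1 nu1] : exists u1, u1 != u0.
  have /card_gt0P[u] : (0 < #|predC1 u0|)%N by rewrite cardC1 U2.
  by rewrite inE; exists u.
exists u0, u1.
have [kp1 km1] : gkp u1 = 0%N /\ gkm u1 = 0%N.
  by move: K1; rewrite (bigD1 u1) //=; lia.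
split=> //; first by rewrite eq_sym.
  move=> u; have h : [:: u0; u1] =i predT.
    apply/subset_cardP; last by apply/subsetP => ?.
    have /card_uniqP -> : uniq [:: u0; u1] by rewrite /= inE eq_sym nu1.
    by rewrite U2.
  by rewrite h.
by apply/negP => /Ev e; rewrite e eqxx in nu1.
Qed.

Lemma reduced_rank2_cases (G : plumbing_graph) :
  reduced G -> has_rank G 2 ->
  [\/ exists u1 u2 : gU G, is_pair u1 u2,
      exists (u1 u2 u3 : gU G) (v : gV G), is_star u1 u2 u3 v,
      exists (u0 u1 : gU G) (v : gV G), is_theta_pair u0 u1 v
    | exists u : gU G, is_single u].
Proof.
move=> hred hr; have [[v hv]|hno] :=
  classic (exists v : gV G, graph_iso (@component G (inr v)) Theta).
  have [u0 [u1 h]] := reduced_rank2_Theta hred hr hv.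
  by constructor 3; exists u0, u1, v.
have [_ _ hdeg _] := hred.
have hd (v : gV G) : (3 <= degV v)%N by apply: hdeg => hv; apply: hno; exists v.
have [h|h|h] := reduced_rank2_no_Theta hred hr hd.
- by constructor 1.
- by constructor 2.
- by constructor 4.
Qed.

(** * The cubic form in coordinates *)

Lemma symb_eqE (G : plumbing_graph) (s t : symb G) :
  (s == t) = (tag s == tag t) && (symb_idx s == symb_idx t).
Proof.
apply/eqP/andP => [->//|[/eqP]]; case: s t => [u i] [u' j] /= eu; subst u'.
rewrite /symb_idx /= => /eqP h; congr Tagged; apply: val_inj => /=; lia.
Qed.

Lemma symb_idx_eq0 (G : plumbing_graph) (s : symb G) :
  (symb_idx s == 0) = (s == symb0 (tag s)).
Proof. by rewrite symb_eqE symb_idx0 eqxx. Qed.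

Lemma sum_if_eq (I : finType) (a : I) (F : I -> int) :
  \sum_i (if i == a then F i else 0) = F a.
Proof. by rewrite -big_mkcond big_pred1_eq. Qed.

Lemma sum_symb0 (G : plumbing_graph) (F : symb G -> int) :
  \sum_(s | symb_idx s == 0) F s = \sum_(u : gU G) F (symb0 u).
Proof.
rewrite (reindex_onto (@symb0 G) (@tag _ _)); last first.
  by move=> s; rewrite symb_idx_eq0 => /eqP.
by apply: eq_bigl => u; rewrite symb_idx0 !eqxx.
Qed.

(** Kronecker deltas let the triple sum collapse one index at a time. The terms are the cube of u^0
    and the three positions of u^0 beside a repeated u^j; the guards on the index keep them
    disjoint. *)
Lemma mu_symb_term k (G : plumbing_graph) (r s t : symb G) (c : int) :
  c * mu_symb k r s t =
    (if t == r then if s == r then if symb_idx r == 0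
       then c * ((lambda k %/ 4)%:Z * galpha (tag r)) else 0 else 0 else 0)
  + (if t == s then if r == symb0 (tag s) then if symb_idx s != 0
       then c * Num.sg (symb_idx s) else 0 else 0 else 0)
  + (if t == r then if s == symb0 (tag r) then if symb_idx r != 0
       then c * Num.sg (symb_idx r) else 0 else 0 else 0)
  + (if t == symb0 (tag r) then if s == r then if symb_idx r != 0
       then c * Num.sg (symb_idx r) else 0 else 0 else 0).
Proof.
rewrite /mu_symb /mu_idx !symb_eqE !symb_idx0 /=.
move: (galpha _) (symb_idx r) (symb_idx s) (symb_idx t) => a i j l.
move: (tag r) (tag s) (tag t) => u v w.
repeat match goal with
| |- context [?x == ?y] => case: (eqVneq x y) => [?|?]; [subst|]; rewrite /=
end.
all: try match goal with H : is_true (?x != ?x) |- _ => by rewrite eqxx in H end.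
all: rewrite ?sgr0 ?mulr0 ?addr0 ?add0r //.
Qed.

Lemma muA_formula k (G : plumbing_graph) (x y z : lattA G) :
  muA k x y z =
    \sum_(u : gU G) (lambda k %/ 4)%:Z * galpha u
        * x (symb0 u) * y (symb0 u) * z (symb0 u)
  + \sum_(s : symb G | symb_idx s != 0) Num.sg (symb_idx s) *
      (x (symb0 (tag s)) * y s * z s + y (symb0 (tag s)) * x s * z s
       + z (symb0 (tag s)) * x s * y s).
Proof.
rewrite /muA; under eq_bigr => r _ do under eq_bigr => s _ do
  under eq_bigr => t _ do rewrite mu_symb_term.
under eq_bigr => r _ do under eq_bigr => s _ do
  rewrite !big_split /= !sum_if_eq.
under eq_bigr => r _ do rewrite !big_split /= !sum_if_eq.
(* In the second term the remaining delta fixes r in terms of s, so the order of summation is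
   exchanged. *)
rewrite !big_split /= exchange_big /=.
under [X in _ + X + _ + _]eq_bigr => s _ do rewrite sum_if_eq.
rewrite -big_mkcond sum_symb0 -!big_mkcond /= -!addrA; congr (_ + _).
  by apply: eq_bigr => u _; ring.
rewrite -!big_split; apply: eq_bigr => s _ /=; ring.
Qed.

Lemma pA_formula k (G : plumbing_graph) (x : lattA G) :
  pA k x = \sum_(u : gU G) x (symb0 u) * ((lambda k)%:Z * galpha u
             + 'C(2 * k + 1, k)%:Z * ((gkp u)%:Z - (gkm u)%:Z)).
Proof.
rewrite -(sum_symb0 (fun s : symb G => x s * ((lambda k)%:Z * galpha (tag s)
             + 'C(2 * k + 1, k)%:Z * ((gkp (tag s))%:Z - (gkm (tag s))%:Z)))).
rewrite [RHS]big_mkcond; apply: eq_bigr => s _; rewrite /p_symb.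
by case: ifP => _; rewrite ?mulr0.
Qed.

(* The sign lets a vertex with label [(a; 0, 1)] have the same coordinate
   expression as one with label [(- a; 1, 0)]. *)
Definition coords (G : plumbing_graph) (b : bool) (s1 s2 : symb G) (x : lattH G) :
  int * int := ((-1) ^+ b * coef s1 x, coef s2 x).

Lemma coords_zmod_morphism (G : plumbing_graph) (b : bool) (s1 s2 : symb G) :
  zmod_morphism (coords b s1 s2).
Proof. by move=> x y; rewrite /coords !raddfB mulrBr. Qed.

HB.instance Definition _ (G : plumbing_graph) (b : bool) (s1 s2 : symb G) :=
  GRing.isZmodMorphism.Build (lattH G) (int * int)%type (coords b s1 s2)
    (coords_zmod_morphism b s1 s2).

(** [A] and [B] are the coefficient vectors of the basis dual to the coordinates at [s1] and [s2];
    they supply the inverse map. *)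
Lemma coords_bij (G : plumbing_graph) (b : bool) (s1 s2 : symb G) (A B : symb G -> int) :
  (forall (x : lattH G) s, coef s x = A s * coef s1 x + B s * coef s2 x) ->
  (forall i j, [ffun s => A s * i + B s * j] \in @inH G) ->
  [/\ A s1 = 1, B s1 = 0, A s2 = 0 & B s2 = 1] ->
  bijective (coords b s1 s2).
Proof.
move=> hx hH [A1 B1 A2 B2].
have sgnK : (-1) ^+ b * (-1) ^+ b = 1 :> int by rewrite -expr2 sqrr_sign.
exists (fun c : int * int => LattH (hH ((-1) ^+ b * c.1) c.2)).
  move=> x; apply: lattH_eq => s; rewrite {1}/coef ffunE /= mulrA sgnK mul1r.
  by rewrite [RHS]hx.
move=> [i j]; rewrite /coords /coef !ffunE A1 B1 A2 B2 /=.
by rewrite !mul1r !mul0r addr0 add0r mulrA sgnK mul1r.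
Qed.

Lemma big_enum_all (T : finType) (r : seq T) (F : T -> int) (P : pred T) :
  uniq r -> (forall u, u \in r) -> \sum_(u | P u) F u = \sum_(u <- r | P u) F u.
Proof.
move=> ur hr; rewrite [LHS]big_mkcond [RHS]big_mkcond [RHS]big_uniq //=.
by apply: eq_bigl => u; rewrite hr.
Qed.

Lemma spin_symb (G : plumbing_graph) (s : symb G) : spin G -> s = symb0 (tag s).
Proof.
move=> hs; case: s => u i; rewrite /symb0; congr Tagged; apply: val_inj => /=.
by have [kp km] := hs u; case: i => i /=; lia.
Qed.

Definition mu_coords k (G : plumbing_graph) (F : int * int -> int * int -> int * int -> int)
    (c : lattH G -> int * int) : Prop :=
  bijective c /\ forall x y z, muH k x y z = F (c x) (c y) (c z).

Definition spin_coords k (G : plumbing_graph) (a1 a2 a3 : int)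
    (c : lattH G -> int * int) : Prop :=
  mu_coords k (fun x y z => (lambda k %/ 4)%:Z * cubic a1 a2 a3 x y z) c /\
  forall x, pH k x = (lambda k)%:Z * linform a1 a2 a3 (c x).

Lemma spin_muH k (G : plumbing_graph) (x y z : lattH G) : spin G ->
  muH k x y z = \sum_(u : gU G) (lambda k %/ 4)%:Z * galpha u
        * coef (symb0 u) x * coef (symb0 u) y * coef (symb0 u) z.
Proof.
move=> hs; rewrite /muH muA_formula [X in _ + X]big1 ?addr0 // => s.
by rewrite (spin_symb s hs) symb_idx0 eqxx.
Qed.

Lemma spin_pH k (G : plumbing_graph) (x : lattH G) : spin G ->
  pH k x = \sum_(u : gU G) (lambda k)%:Z * galpha u * coef (symb0 u) x.
Proof.
move=> hs; rewrite /pH pA_formula; apply: eq_bigr => u _.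
by have [-> ->] := hs u; rewrite subrr mulr0 addr0 mulrC.
Qed.

Lemma pair_coords k (G : plumbing_graph) (u1 u2 : gU G) : is_pair u1 u2 ->
  spin_coords k (galpha u1) (galpha u2) 0 (coords false (symb0 u1) (symb0 u2)).
Proof.
move=> [n12 hU noV hs].
have ur : uniq [:: u1; u2] by rewrite /= inE n12.
split; [split|].
- apply: (@coords_bij _ _ _ _ (fun s => (tag s == u1)%:R) (fun s => (tag s == u2)%:R)).
  + move=> x s; rewrite {1}(spin_symb s hs); have := hU (tag s).
    rewrite !inE => /orP[] /eqP ->; first by rewrite eqxx (negbTE n12) mul1r mul0r addr0.
    by rewrite eq_sym (negbTE n12) eqxx mul1r mul0r add0r.
  + by move=> i j; apply/forallP => v; case: (noV v).
  + by rewrite /= !eqxx [u2 == u1]eq_sym (negbTE n12).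
- move=> x y z; rewrite spin_muH // (@big_enum_all _ [:: u1; u2]) //.
  by rewrite !big_cons big_nil /cubic /coords /=; ring.
- move=> x; rewrite spin_pH // (@big_enum_all _ [:: u1; u2]) //.
  by rewrite !big_cons big_nil /linform /coords /=; ring.
Qed.

Lemma star_coords k (G : plumbing_graph) (u1 u2 u3 : gU G) (v : gV G) :
  is_star u1 u2 u3 v ->
  spin_coords k (galpha u1) (galpha u2) (galpha u3) (coords false (symb0 u1) (symb0 u2)).
Proof.
move=> [ur hU hV hE hs _].
have x3 (x : lattH G) : coef (symb0 u3) x = - (coef (symb0 u1) x + coef (symb0 u2) x).
  have := coef_inH x v; rewrite (@big_enum_all _ [:: u1; u2; u3]) //.
  by rewrite !big_cons big_nil !hE; lra.
have [n12 n13 n23] : [/\ u1 != u2, u1 != u3 & u2 != u3].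
  by move: ur; rewrite /= !inE negb_or andbT => /andP[/andP[-> ->] ->].
split; [split|].
(* The basis of the kernel lattice is u1^0 - u3^0, u2^0 - u3^0. *)
- apply: (@coords_bij _ _ _ _ (fun s => (tag s == u1)%:R - (tag s == u3)%:R)
                              (fun s => (tag s == u2)%:R - (tag s == u3)%:R)).
  + move=> x s; rewrite {1}(spin_symb s hs); have := hU (tag s).
    rewrite !inE => /or3P[] /eqP ->; rewrite ?x3 ?eqxx.
    * by rewrite (negbTE n12) (negbTE n13) /=; ring.
    * by rewrite [u2 == u1]eq_sym (negbTE n12) (negbTE n23) /=; ring.
    * by rewrite [u3 == u1]eq_sym [u3 == u2]eq_sym (negbTE n13) (negbTE n23) /=; ring.
  + move=> i j; apply/forallP => v'; rewrite (hV v') (@big_enum_all _ [:: u1; u2; u3]) //.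
    rewrite !big_cons big_nil !hE !ffunE /= !eqxx [u2 == u1]eq_sym [u3 == u1]eq_sym
      [u3 == u2]eq_sym (negbTE n12) (negbTE n13) (negbTE n23) /=; apply/eqP; ring.
  + by rewrite /= !eqxx [u2 == u1]eq_sym (negbTE n12) (negbTE n13) (negbTE n23) /= !subr0.
- move=> x y z; rewrite spin_muH // (@big_enum_all _ [:: u1; u2; u3]) //.
  by rewrite !big_cons big_nil !x3 /cubic /coords /=; ring.
- move=> x; rewrite spin_pH // (@big_enum_all _ [:: u1; u2; u3]) //.
  by rewrite !big_cons big_nil !x3 /linform /coords /=; ring.
Qed.

Definition degenerate_form k (a : int) (x y z : int * int) : int :=
  (lambda k %/ 4)%:Z * a * x.1 * y.1 * z.1.

Definition nondegenerate_form k (a : int) (x y z : int * int) : int :=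
  (lambda k %/ 4)%:Z * a * x.1 * y.1 * z.1
  + x.1 * y.2 * z.2 + y.1 * x.2 * z.2 + z.1 * x.2 * y.2.

(** The equation at v kills the coefficient of u0^0, so u0^1 lies in the radical of [muH] and only
    the cube at u1 survives. *)
Lemma theta_pair_coords k (G : plumbing_graph) (u0 u1 : gU G) (v : gV G) :
  is_theta_pair u0 u1 v -> exists c : {additive lattH G -> int * int},
    mu_coords k (degenerate_form k (galpha u1)) c.
Proof.
move=> [n01 hU hV E0 E1 _ kp0 km0 kp1 km1].
pose s1 : symb G := Tagged (fun u : gU G => 'I_(gkm u + gkp u).+1)
  (ord_max : 'I_(gkm u0 + gkp u0).+1).
have hsymb s : [\/ s = symb0 u0, s = symb0 u1 | s = s1].
  case: s => u i; have := hU u; rewrite !inE => /orP[] /eqP eu; subst u.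
    have [h|h] : val i = 0%N \/ val i = 1%N by move: i => -[i /=]; lia.
      by constructor 1; rewrite /symb0; congr Tagged; apply: val_inj; rewrite [LHS]h /= km0.
    constructor 3; rewrite /s1; congr Tagged; apply: val_inj; rewrite [LHS]h /=; lia.
  constructor 2; rewrite /symb0; congr Tagged; apply: val_inj => /=.
  by move: i => -[i /=]; lia.
have x0 (x : lattH G) : coef (symb0 u0) x = 0.
  have := coef_inH x v; rewrite (@big_enum_all _ [:: u0; u1]) //; last by rewrite /= inE n01.
  by rewrite !big_cons big_nil E0 E1 addr0.
have s1n u : (s1 == symb0 u) = false.
  rewrite symb_eqE symb_idx0 /= /symb_idx /= km0 kp0.
  by case: (u0 == u).
have e01 : (symb0 u0 == symb0 u1) = false by rewrite symb_eqE /= (negbTE n01).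
have ns1 u : (symb0 u == s1) = false by rewrite eq_sym s1n.
exists (coords false (symb0 u1) s1); split.
- apply: (@coords_bij _ _ _ _ (fun s => (s == symb0 u1)%:R) (fun s => (s == s1)%:R)).
  + move=> x s; case: (hsymb s) => ->.
    * by rewrite x0 e01 ns1 !mul0r addr0.
    * by rewrite eqxx ns1 mul1r mul0r addr0.
    * by rewrite eqxx s1n mul1r mul0r add0r.
  + move=> i j; apply/forallP => v'; rewrite (hV v') (@big_enum_all _ [:: u0; u1]) //;
      last by rewrite /= inE n01.
    by rewrite !big_cons big_nil E0 E1 addr0 ffunE e01 ns1 !mul0r addr0.
  + by rewrite !eqxx ns1 s1n.
- move=> x y z; rewrite /muH muA_formula (@big_enum_all _ [:: u0; u1]) //;
    last by rewrite /= inE n01.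
  rewrite !big_cons big_nil [X in _ + X]big1 => [|s].
    rewrite -!/(coef _ _) !x0 /degenerate_form /coords /=; ring.
  case: (hsymb s) => ->; rewrite ?symb_idx0 ?eqxx // => _.
  by rewrite -!/(coef _ _) !x0; ring.
Qed.

(** For the label (a; 0, 1) the mixed terms carry the sign -1. Negating the u^0 coordinate, which
    has odd degree in every term, gives the form of (-a; 1, 0). *)
Lemma single_coords k (G : plumbing_graph) (u : gU G) : is_single u ->
  exists c : {additive lattH G -> int * int}, mu_coords k
    (nondegenerate_form k (if gkm u == 0%N then galpha u else - galpha u)) c.
Proof.
move=> [hU noV hk].
have [s1 [hidx hsymb]] : exists s1 : symb G,
    symb_idx s1 = (if gkm u == 0%N then 1 else -1) /\ forall s, s = symb0 u \/ s = s1.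
  case: hk => [[kp km]|[kp km]]; rewrite km /=.
    exists (Tagged (fun u : gU G => 'I_(gkm u + gkp u).+1)
      (ord_max : 'I_(gkm u + gkp u).+1)); split; first by rewrite /symb_idx /= kp km.
    case=> u' i; have eu := hU u'; subst u'.
    have [h|h] : val i = 0%N \/ val i = 1%N by move: i => -[i /=]; lia.
      by left; rewrite /symb0; congr Tagged; apply: val_inj; rewrite [LHS]h /= km.
    by right; congr Tagged; apply: val_inj; rewrite [LHS]h /= kp km.
  (* Indices are stored shifted by [gkm], so u^{-1} sits at 0 and u^0 at 1. *)
  exists (Tagged (fun u : gU G => 'I_(gkm u + gkp u).+1)
    (ord0 : 'I_(gkm u + gkp u).+1)); split; first by rewrite /symb_idx /= km.
  case=> u' i; have eu := hU u'; subst u'.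
  have [h|h] : val i = 0%N \/ val i = 1%N by move: i => -[i /=]; lia.
    by right; congr Tagged; apply: val_inj; rewrite [LHS]h.
  by left; rewrite /symb0; congr Tagged; apply: val_inj; rewrite [LHS]h /= km.
have s1n : (s1 == symb0 u) = false.
  by rewrite symb_eqE symb_idx0 hidx; case: ifP; rewrite andbF.
have ns1 : (symb0 u == s1) = false by rewrite eq_sym s1n.
have tag1 : tag s1 = u by exact: hU.
exists (coords (gkm u != 0%N) (symb0 u) s1); split.
- apply: (@coords_bij _ _ _ _ (fun s => (s == symb0 u)%:R) (fun s => (s == s1)%:R)).
  + move=> x s; case: (hsymb s) => ->.
      by rewrite eqxx ns1 mul1r mul0r addr0.
    by rewrite eqxx s1n mul1r mul0r add0r.
  + by move=> i j; apply/forallP => v; case: (noV v).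
  + by rewrite !eqxx ns1 s1n.
- move=> x y z; rewrite /muH muA_formula (@big_enum_all _ [:: u]) //; last first.
    by move=> u'; rewrite (hU u') mem_head.
  rewrite big_cons big_nil (big_pred1 s1) => [|s]; last first.
    case: (hsymb s) => ->; first by rewrite symb_idx0 eqxx /= ns1.
    by rewrite /= eqxx hidx; case: ifP.
  rewrite -!/(coef _ _) tag1 hidx /nondegenerate_form /coords.
  case: (gkm u == 0%N) => /=; rewrite ?expr0 ?expr1 /=.
    by rewrite sgr1; ring.
  by rewrite sgrN1; ring.
Qed.

(** * k-equivalence *)

Lemma k_equivalent_sym k (G G' : plumbing_graph) :
  k_equivalent k G G' -> k_equivalent k G' G.
Proof.
move=> [phi [[psi phiK psiK] hmu [z hz] hp]].
have psiB : zmod_morphism psi.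
  by move=> x y; apply: (can_inj phiK); rewrite raddfB !psiK.
pose psi_mixin := GRing.isZmodMorphism.Build _ _ psi psiB.
pose psi_add : {additive lattH G' -> lattH G} := HB.pack psi psi_mixin.
exists psi_add; split=> /=.
- by exists phi.
- by move=> x y t; rewrite -hmu !psiK.
- exists (psi (- z)); apply: (can_inj phiK).
  by rewrite raddfB raddfMn /= !psiK mulNrn -hz opprB.
- by move=> x; rewrite -hp psiK.
Qed.

Lemma k_equivalent_trans k (G1 G2 G3 : plumbing_graph) :
  k_equivalent k G1 G2 -> k_equivalent k G2 G3 -> k_equivalent k G1 G3.
Proof.
move=> [f [bf mf [z hz] pf]] [g [bg mg [t ht] pg]].
exists (g \o f : {additive _ -> _}); split=> /=.
- exact: bij_comp.
- by move=> x y w; rewrite mg mf.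
- exists (g z + t); rewrite mulrnDl -ht -raddfMn -hz raddfB /=.
  by rewrite addrA subrK.
- by move=> x; rewrite pg pf.
Qed.

Lemma k_equivalent_has_rank k (G G' : plumbing_graph) n :
  k_equivalent k G G' -> has_rank G n -> has_rank G' n.
Proof.
move=> [phi [[psi phiK psiK] _ _ _]] [b hb]; exists (phi \o b) => x.
have sumE (c : {ffun 'I_n -> int}) :
    \sum_(i < n) (phi \o b) i *~ c i = phi (\sum_(i < n) b i *~ c i).
  by rewrite raddf_sum; apply: eq_bigr => i _; rewrite raddfMz.
have [c [hc cu]] := hb (psi x); exists c; split; first by rewrite sumE -hc psiK.
by move=> c'; rewrite sumE => hx; apply: cu; rewrite hx phiK.
Qed.

(** If G' is spin, its w vanishes, so w of G is divisible by 2. Its coefficients at nonzero indices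
    are 1, so no such index exists. *)
Lemma k_equivalent_spin k (G G' : plumbing_graph) :
  k_equivalent k G G' -> spin G' -> spin G.
Proof.
move=> [phi [[psi phiK psiK] _ [z hz] _]] hs.
have w0 : wH G' = 0.
  by apply: lattH_eq => s; rewrite raddf0 /coef ffunE (spin_symb s hs) symb_idx0 eqxx.
have wE : wH G = psi z *+ 2.
  by apply: (can_inj phiK); rewrite raddfMn /= psiK -hz w0 subr0.
have idx0 (s : symb G) : symb_idx s = 0.
  apply/eqP; apply: contraT => hidx.
  have := congr1 (coef s) wE; rewrite raddfMn {1}/coef ffunE (negbTE hidx) /=.
  by move: (coef _ _) => x; clear; lia.
move=> u; split.
  have := idx0 (Tagged (fun u : gU G => 'I_(gkm u + gkp u).+1)
    (ord_max : 'I_(gkm u + gkp u).+1)).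
  by rewrite /symb_idx /=; lia.
have := idx0 (Tagged (fun u : gU G => 'I_(gkm u + gkp u).+1)
  (ord0 : 'I_(gkm u + gkp u).+1)).
by rewrite /symb_idx /=; lia.
Qed.

Lemma pair_mulrz (p : int * int) (n : int) : p *~ n = (p.1 * n, p.2 * n).
Proof. by apply: injective_projections; rewrite raddfMz mulrzz. Qed.

Lemma additive_coords_change (M M' : zmodType) (c : {additive M -> int * int})
    (c' : {additive M' -> int * int}) (phi : {additive M -> M'}) :
  bijective c -> bijective c' -> bijective phi ->
  exists m11 m12 m21 m22 : int,
    (m11 * m22 - m12 * m21) ^+ 2 = 1 /\
    forall x, c' (phi x) = mxact m11 m12 m21 m22 (c x).
Proof.
move=> [d cK dK] [d' cK' dK'] [psi phiK psiK].
pose e1 := d (1, 0); pose e2 := d (0, 1).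
have decomp x : x = e1 *~ (c x).1 + e2 *~ (c x).2.
  apply: (can_inj cK); rewrite raddfD !raddfMz /= !dK.
  by rewrite !pair_mulrz; apply: injective_projections => /=; ring.
have hM x : c' (phi x) = mxact (c' (phi e1)).1 (c' (phi e2)).1
    (c' (phi e1)).2 (c' (phi e2)).2 (c x).
  rewrite {1}(decomp x) !raddfD !raddfMz /mxact.
  by rewrite !pair_mulrz; apply: injective_projections => /=; ring.
exists (c' (phi e1)).1, (c' (phi e2)).1, (c' (phi e1)).2, (c' (phi e2)).2.
split=> //.
(* The preimages of the two basis vectors form an integral right inverse of the matrix, so its
   determinant divides 1. *)
move: (hM (psi (d' (1, 0)))) (hM (psi (d' (0, 1)))); rewrite !psiK !dK' /mxact.
move: (c (psi (d' (1, 0)))) (c (psi (d' (0, 1)))) (c' (phi e1)) (c' (phi e2)).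
move=> [x y] [z t] [p r] [q s] /= [h1 h2] [h3 h4].
have h : (p * s - q * r) * (x * t - z * y) = 1.
  transitivity ((p * x + q * y) * (r * z + s * t) - (p * z + q * t) * (r * x + s * y)).
    by ring.
  by rewrite -h1 -h2 -h3 -h4.
have /(congr1 absz) := h; rewrite abszM => /eqP; rewrite muln_eq1 => /andP[/eqP hd _].
by move: (p * s - q * r) hd; clear => D; nia.
Qed.

Lemma lambda4_neq0 k : (0 < k)%N -> (lambda k %/ 4)%:Z != 0.
Proof.
move=> k0; suff : (0 < lambda k %/ 4)%N by case: (_ %/ _)%N.
rewrite divn_gt0 // dvdn_leq ?dvdn4_lambda // /lambda !muln_gt0 fact_gt0 andbT /nu.
by rewrite !natn; case: (odd k); case: ifP => // _; case: ifP.
Qed.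

(** The nonzero factors [lambda k %/ 4] and [lambda k] cancel, which removes k from the problem. *)
Lemma k_equivalent_triple_equiv k (G G' : plumbing_graph) a1 a2 a3 b1 b2 b3
    (c : {additive lattH G -> int * int}) (c' : {additive lattH G' -> int * int}) :
  (0 < k)%N -> k_equivalent k G G' ->
  spin_coords k a1 a2 a3 c -> spin_coords k b1 b2 b3 c' ->
  triple_equiv a1 a2 a3 b1 b2 b3.
Proof.
move=> k0 [phi [bphi hmu _ hp]] [[bc hF] hL] [[bc' hF'] hL'].
have [m11 [m12 [m21 [m22 [dt hM]]]]] := additive_coords_change bc bc' bphi.
exists m11, m12, m21, m22; split=> //.
  case: bc => d cK dK x y z; rewrite -[x]dK -[y]dK -[z]dK -!hM.
  by apply: (mulfI (lambda4_neq0 k0)); rewrite -hF -hF' hmu.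
have l0 : (lambda k)%:Z != 0.
  by apply: contraNneq (lambda4_neq0 k0) => -[->].
case: bc => d cK dK x; rewrite -[x]dK -!hM.
by apply: (mulfI l0); rewrite -hL -hL' hp.
Qed.

Lemma k_equivalent_form k (G G' : plumbing_graph) F F'
    (c : {additive lattH G -> int * int}) (c' : {additive lattH G' -> int * int}) :
  k_equivalent k G G' -> mu_coords k F c -> mu_coords k F' c' ->
  exists m11 m12 m21 m22 : int,
    (m11 * m22 - m12 * m21) ^+ 2 = 1 /\
    forall x y z, F' (mxact m11 m12 m21 m22 x) (mxact m11 m12 m21 m22 y)
                     (mxact m11 m12 m21 m22 z) = F x y z.
Proof.
move=> [phi [bphi hmu _ hp]] [bc hF] [bc' hF'].
have [m11 [m12 [m21 [m22 [dt hM]]]]] := additive_coords_change bc bc' bphi.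
exists m11, m12, m21, m22; split=> //.
case: bc => d cK dK x y z; rewrite -[x]dK -[y]dK -[z]dK -!hM.
by rewrite -hF -hF' hmu.
Qed.

(** On the basis vectors, a = b m11^3 and b m12^3 = 0. Either b = 0, or m12 = 0 and the determinant
    makes m11 a unit. *)
Lemma degenerate_form_equiv k (a b m11 m12 m21 m22 : int) : (0 < k)%N ->
  (m11 * m22 - m12 * m21) ^+ 2 = 1 ->
  (forall x y z, degenerate_form k b (mxact m11 m12 m21 m22 x)
     (mxact m11 m12 m21 m22 y) (mxact m11 m12 m21 m22 z) = degenerate_form k a x y z) ->
  `|a| = `|b|.
Proof.
move=> k0 dt hF; have l0 := lambda4_neq0 k0.
have e1 : a = b * m11 ^+ 3.
  apply: (mulfI l0); have := hF (1, 0) (1, 0) (1, 0).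
  rewrite /degenerate_form /mxact /= => h.
  by transitivity ((lambda k %/ 4)%:Z * a * 1 * 1 * 1); [ring|rewrite -h; ring].
have : b * m12 ^+ 3 = 0.
  apply: (mulfI l0); have := hF (0, 1) (0, 1) (0, 1).
  rewrite /degenerate_form /mxact /= => h.
  by transitivity ((lambda k %/ 4)%:Z * a * 0 * 0 * 0); [rewrite -h; ring|ring].
move/eqP; rewrite mulf_eq0 => /orP[/eqP b0|]; first by rewrite e1 b0 mul0r.
rewrite expf_eq0 /= => /eqP m0; rewrite m0 mul0r subr0 exprMn in dt.
have h1 : `|m11| = 1.
  have /(congr1 absz) := dt; rewrite abszM => /eqP; rewrite muln_eq1 => /andP[/eqP hd _].
  by move: hd; clear; nia.
by rewrite e1 normrM normrX h1 expr1n mulr1.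
Qed.

(** The four coefficient equations force m12 = 0 by parity, then m11 = 1 from 1 = m11 m22^2, then
    m21 = 0, after which the first one reads a = b. *)
Lemma nondegenerate_form_equiv k (a b m11 m12 m21 m22 : int) : (0 < k)%N ->
  (forall x y z, nondegenerate_form k b (mxact m11 m12 m21 m22 x)
     (mxact m11 m12 m21 m22 y) (mxact m11 m12 m21 m22 z) = nondegenerate_form k a x y z) ->
  a = b.
Proof.
move=> k0 hF; have l0 := lambda4_neq0 k0.
rewrite /nondegenerate_form /mxact in hF; move: l0 hF.
move: ((lambda k %/ 4)%:Z) => l l0 hF.
have e1 : l * a = l * b * m11 ^+ 3 + 3 * m11 * m21 ^+ 2.
  transitivity (l * a * 1 * 1 * 1 + 1 * 0 * 0 + 1 * 0 * 0 + 1 * 0 * 0); first by ring.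
  by rewrite -(hF (1, 0) (1, 0) (1, 0)) /=; ring.
have e2 : 0 = l * b * m11 ^+ 2 * m12 + 2 * m11 * m21 * m22 + m12 * m21 ^+ 2.
  transitivity (l * a * 1 * 1 * 0 + 1 * 0 * 1 + 1 * 0 * 1 + 0 * 0 * 0 : int); first by ring.
  by rewrite -(hF (1, 0) (1, 0) (0, 1)) /=; ring.
have e3 : 1 = l * b * m11 * m12 ^+ 2 + m11 * m22 ^+ 2 + 2 * m12 * m21 * m22.
  transitivity (l * a * 1 * 0 * 0 + 1 * 1 * 1 + 0 * 0 * 1 + 0 * 0 * 1 : int); first by ring.
  by rewrite -(hF (1, 0) (0, 1) (0, 1)) /=; ring.
have e4 : 0 = m12 * (l * b * m12 ^+ 2 + 3 * m22 ^+ 2).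
  transitivity (l * a * 0 * 0 * 0 + 0 * 1 * 1 + 0 * 1 * 1 + 0 * 1 * 1 : int); first by ring.
  by rewrite -(hF (0, 1) (0, 1) (0, 1)) /=; ring.
have m0 : m12 = 0.
  move/eqP: e4; rewrite eq_sym mulf_eq0 => /orP[/eqP //|/eqP h].
  (* Subtracting m11 times the vanishing factor from [e3] would make 1 even. *)
  have : 1 = 2 * (m22 * (m12 * m21 - m11 * m22)).
    transitivity (m11 * (l * b * m12 ^+ 2 + 3 * m22 ^+ 2)
      + 2 * (m22 * (m12 * m21 - m11 * m22))); last by rewrite h mulr0 add0r.
    by rewrite {1}e3; ring.
  by move: (m22 * _) => X; clear; lia.
subst m12; rewrite ?(mul0r, mulr0, expr0n, addr0, add0r) /= ?(mul0r, mulr0, addr0, add0r) in e2 e3.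
have hm11 : m11 = 1.
  have /(congr1 absz) := e3; rewrite abszM => /esym/eqP; rewrite muln_eq1 => /andP[/eqP hd _].
  have [//|h] : m11 = 1 \/ m11 = -1 by move: hd; clear; lia.
  by move: e3 (sqr_ge0 m22); rewrite h; clear; lia.
subst m11; have hm22 : m22 != 0 by apply: contra_eq_neq e3 => ->; rewrite expr0n mulr0.
have hm21 : m21 = 0.
  move/eqP: e2; rewrite eq_sym !mulf_eq0 (negbTE hm22) orbF /=.
  by rewrite ?orbF /= => /eqP.
by apply: (mulfI l0); rewrite e1 hm21; ring.
Qed.

(** Write l for [lambda k %/ 4]. The value 1 on one first and two second basis vectors needs l b and
    m12 nonzero, while the value 0 on three second ones makes l b m12^3 vanish. *)
Lemma nondegenerate_not_degenerate k (a b m11 m12 m21 m22 : int) :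
  ~ (forall x y z, degenerate_form k b (mxact m11 m12 m21 m22 x)
     (mxact m11 m12 m21 m22 y) (mxact m11 m12 m21 m22 z) = nondegenerate_form k a x y z).
Proof.
rewrite /nondegenerate_form /degenerate_form /mxact.
move: ((lambda k %/ 4)%:Z) => l hF.
have e3 : 1 = l * b * m11 * m12 ^+ 2.
  transitivity (l * a * 1 * 0 * 0 + 1 * 1 * 1 + 0 * 0 * 1 + 0 * 0 * 1 : int); first by ring.
  by rewrite -(hF (1, 0) (0, 1) (0, 1)) /=; ring.
have : 0 = l * b * m12 ^+ 3.
  transitivity (l * a * 0 * 0 * 0 + 0 * 1 * 1 + 0 * 1 * 1 + 0 * 1 * 1 : int); first by ring.
  by rewrite -(hF (0, 1) (0, 1) (0, 1)) /=; ring.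
move/eqP; rewrite eq_sym mulf_eq0 expf_eq0 /= => /orP[]/eqP h.
  by move: e3; rewrite h !mul0r.
by move: e3; rewrite h expr0n mulr0.
Qed.

(** * Comparing the graphs of rank 2 *)

Lemma pair_graph_iso (G : plumbing_graph) (u1 u2 : gU G) : is_pair u1 u2 ->
  graph_iso G (disjoint_union (isolated_vertex (galpha u1) 0 0)
                              (isolated_vertex (galpha u2) 0 0)).
Proof.
move=> [n12 hU noV hs]; apply: graph_iso_sym.
exists (fun u => match u with inl _ => u1 | inr _ => u2 end),
  (fun v : void + void => match v with inl v | inr v => of_void (gV G) v end).
split=> [||[]|] //.
- exists (fun u => if u == u1 then inl tt else inr tt).
    by move=> [[]|[]]; rewrite ?eqxx // eq_sym (negbTE n12).
  by move=> u; have := hU u; rewrite !inE; case: eqP => [->|_] //= /eqP ->.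
- by exists (fun v => match noV v with end) => [[]|v] //; case: (noV v).
- by move=> u [].
- by move=> u []; case.
- by case=> u; [have [-> ->] := hs u1|have [-> ->] := hs u2].
Qed.

Lemma star_graph_iso (G : plumbing_graph) (u1 u2 u3 : gU G) (v : gV G) :
  is_star u1 u2 u3 v ->
  graph_iso G (star3 (fun i => galpha (nth u1 [:: u1; u2; u3] i))).
Proof.
move=> [ur hU hV hE hs _]; apply: graph_iso_sym.
exists (fun i : 'I_3 => nth u1 [:: u1; u2; u3] i), (fun _ => v); split=> //.
- exists (fun u => inord (index u [:: u1; u2; u3])).
    by move=> i; apply: ord_inj; rewrite inordK !index_uniq.
  move=> u; have := index_mem u [:: u1; u2; u3]; rewrite hU => hlt.
  by rewrite inordK ?nth_index.
- by exists (fun _ => tt) => [[]|v'].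
- by move=> u v'; rewrite hE.
- by move=> i; have [-> ->] := hs (nth u1 [:: u1; u2; u3] i).
Qed.

Lemma theta_pair_graph_iso (G : plumbing_graph) (u0 u1 : gU G) (v : gV G) :
  is_theta_pair u0 u1 v ->
  graph_iso G (disjoint_union Theta (isolated_vertex (galpha u1) 0 0)).
Proof.
move=> [n01 hU hV E0 E1 a0 kp0 km0 kp1 km1]; apply: graph_iso_sym.
exists (fun u => match u with inl _ => u0 | inr _ => u1 end), (fun _ => v).
split.
- exists (fun u => if u == u0 then inl tt else inr tt).
    by move=> [[]|[]]; rewrite ?eqxx // eq_sym (negbTE n01).
  by move=> u; have := hU u; rewrite !inE; case: eqP => [->|_] //= /eqP ->.
- by exists (fun _ => inl tt) => [[[]|[]]|v'].
- by move=> [] [] [] // [].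
- by case.
Qed.

Lemma single_graph_iso (G : plumbing_graph) (u : gU G) : is_single u ->
  graph_iso G (isolated_vertex (galpha u) (gkp u) (gkm u)).
Proof.
move=> [hU noV _]; apply: graph_iso_sym.
exists (fun _ => u), (of_void (gV G)); split=> //.
- by exists (fun _ => tt) => [[]|u'].
- by exists (fun v => match noV v with end) => [[]|v] //; case: (noV v).
Qed.

(* The isolated pair is encoded as a star whose third label is 0. *)
Definition spin_shape (G : plumbing_graph) (a1 a2 a3 : int) : Prop :=
  (a3 = 0 /\ graph_iso G (disjoint_union (isolated_vertex a1 0 0)
                                         (isolated_vertex a2 0 0)))
  \/ exists a : 'I_3 -> int, [/\ forall i, a i <> 0, graph_iso G (star3 a)
       & [:: a1; a2; a3] = [:: a ord0; a (inord 1); a ord_max]].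

Lemma reduced_rank2_spin k (G : plumbing_graph) :
  reduced G -> has_rank G 2 -> spin G ->
  exists (a1 a2 a3 : int) (c : {additive lattH G -> int * int}),
    spin_shape G a1 a2 a3 /\ spin_coords k a1 a2 a3 c.
Proof.
move=> hred hr hs.
have [[u1 [u2 h]]|[u1 [u2 [u3 [v h]]]]|[u0 [u1 [v h]]]|[u h]] :=
  reduced_rank2_cases hred hr.
- exists (galpha u1), (galpha u2), 0, (coords false (symb0 u1) (symb0 u2)).
  by split; [left; split=> //; exact: pair_graph_iso|exact: pair_coords].
- exists (galpha u1), (galpha u2), (galpha u3), (coords false (symb0 u1) (symb0 u2)).
  split; last exact: (star_coords k h).
  right; exists (fun i => galpha (nth u1 [:: u1; u2; u3] i)); split.
  + by move=> i; apply: (star_alpha h).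
  + exact: star_graph_iso h.
  + by rewrite inordK.
- by have [] := hs u0; rewrite (tpair_kp h).
- by have [] := hs u; case: (single_k h) => -[-> ->].
Qed.

(** The encoding of a pair contains a zero and that of a star does not, so a permutation up to sign
    cannot mix the two shapes. *)
Lemma spin_shape_eq_reduced_class (G G' : plumbing_graph) a1 a2 a3 b1 b2 b3 (e : bool) :
  spin_shape G a1 a2 a3 -> spin_shape G' b1 b2 b3 ->
  perm_eq [:: a1; a2; a3] [seq (-1) ^+ e * x | x <- [:: b1; b2; b3]] ->
  eq_reduced_class G G'.
Proof.
have sgn0 (x : int) : (-1) ^+ e * x = 0 -> x = 0.
  by move/eqP; rewrite mulf_eq0 signr_eq0 => /eqP.
move=> [[-> hG]|[a [na hG ea]]] [[-> hG']|[b [nb hG' eb]]] hp.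
- apply: eq_reduced_class_trans (graph_iso_eq_reduced_class hG) _.
  apply: eq_reduced_class_trans (eq_reduced_class_sym (graph_iso_eq_reduced_class hG')).
  apply: (@pair_eq_reduced_class _ _ _ _ e).
  by move: hp; rewrite /= mulr0 -[[:: a1; a2; 0]]/([:: a1; a2] ++ [:: 0])
    -[[:: _; _; 0]]/([:: _; _] ++ [:: 0]) perm_cat2r.
- exfalso; have : 0 \in [:: a1; a2; 0] by rewrite !inE eqxx !orbT.
  rewrite (perm_mem hp) eb => /mapP[x].
  by rewrite !inE => /or3P[]/eqP -> /esym/sgn0; exact: nb.
- exfalso; have : 0 \in [seq (-1) ^+ e * x | x <- [:: b1; b2; 0]].
    by apply/mapP; exists 0; rewrite ?inE ?eqxx ?orbT ?mulr0.
  by rewrite -(perm_mem hp) ea !inE => /or3P[]/eqP/esym; exact: na.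
- apply: eq_reduced_class_trans (graph_iso_eq_reduced_class hG) _.
  apply: eq_reduced_class_trans (eq_reduced_class_sym (graph_iso_eq_reduced_class hG')).
  by apply: (@star3_eq_reduced_class _ _ e); rewrite -ea -eb.
Qed.

Lemma triple_equiv_eq_reduced_class (G G' : plumbing_graph) a1 a2 a3 b1 b2 b3 :
  spin_shape G a1 a2 a3 -> spin_shape G' b1 b2 b3 ->
  triple_equiv a1 a2 a3 b1 b2 b3 ->
  sig1 a1 a2 a3 ^+ 2 = sig1 b1 b2 b3 ^+ 2 -> sig2 a1 a2 a3 = sig2 b1 b2 b3 ->
  eq_reduced_class G G'.
Proof.
move=> hG hG' hE h1 h2; have [e [g1 g3]] := triple_equiv_sig3 hE h1 h2.
exact: spin_shape_eq_reduced_class hG hG' (perm_eq_of_sig g1 h2 g3).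
Qed.

(** The bound of one further class in pigeonhole form: two of any three k-equivalent classes
    coincide. *)
Lemma spin_k_equivalent_trichotomy k (G G1 G2 : plumbing_graph) : (0 < k)%N ->
  reduced G -> has_rank G 2 -> spin G -> reduced G1 -> reduced G2 ->
  k_equivalent k G1 G -> k_equivalent k G2 G ->
  [\/ eq_reduced_class G1 G, eq_reduced_class G2 G | eq_reduced_class G1 G2].
Proof.
move=> k0 hred hr hs hred1 hred2 h1 h2.
have h12 := k_equivalent_trans h1 (k_equivalent_sym h2).
have hr1 := k_equivalent_has_rank (k_equivalent_sym h1) hr.
have hr2 := k_equivalent_has_rank (k_equivalent_sym h2) hr.
have [a1 [a2 [a3 [ca [sa fa]]]]] :=
  reduced_rank2_spin k hred1 hr1 (k_equivalent_spin h1 hs).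
have [b1 [b2 [b3 [cb [sb fb]]]]] := reduced_rank2_spin k hred hr hs.
have [c1 [c2 [c3 [cc [sc fc]]]]] :=
  reduced_rank2_spin k hred2 hr2 (k_equivalent_spin h2 hs).
have eab := k_equivalent_triple_equiv k0 h1 fa fb.
have eba := k_equivalent_triple_equiv k0 (k_equivalent_sym h1) fb fa.
have ecb := k_equivalent_triple_equiv k0 h2 fc fb.
have eac := k_equivalent_triple_equiv k0 h12 fa fc.
case: (triple_equiv_pigeonhole eab eba ecb) => [[e1 e2]|[e1 e2]|[e1 e2]].
- by constructor 1; exact: triple_equiv_eq_reduced_class sa sb eab e1 e2.
- by constructor 2; exact: triple_equiv_eq_reduced_class sc sb ecb e1 e2.
- by constructor 3; exact: triple_equiv_eq_reduced_class sa sc eac e1 e2.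
Qed.

Lemma reduced_rank2_nonspin k (G : plumbing_graph) :
  reduced G -> has_rank G 2 -> ~ spin G ->
  exists (a : int) (c : {additive lattH G -> int * int}),
    (eq_reduced_class G (disjoint_union Theta (isolated_vertex a 0 0)) /\
     mu_coords k (degenerate_form k a) c)
    \/ (eq_reduced_class G (isolated_vertex a 1 0) /\
        mu_coords k (nondegenerate_form k a) c).
Proof.
move=> hred hr hs.
have [[u1 [u2 h]]|[u1 [u2 [u3 [v h]]]]|[u0 [u1 [v h]]]|[u h]] :=
  reduced_rank2_cases hred hr.
- by case: hs; exact: pair_spin h.
- by case: hs; exact: star_spin h.
- have [c hc] := theta_pair_coords k h; exists (galpha u1), c; left; split=> //.
  exact: graph_iso_eq_reduced_class (theta_pair_graph_iso h).
- have [c hc] := single_coords k h.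
  exists (if gkm u == 0%N then galpha u else - galpha u), c; right; split=> //.
  have := graph_iso_eq_reduced_class (single_graph_iso h).
  case: (single_k h) => [[-> ->]|[-> ->]] //= hG.
  exact: eq_reduced_class_trans hG (isolated_opp_eq_reduced_class _ _ _).
Qed.

Lemma nonspin_k_equivalent_unique k (G G' : plumbing_graph) : (0 < k)%N ->
  reduced G -> has_rank G 2 -> ~ spin G -> reduced G' ->
  k_equivalent k G' G -> eq_reduced_class G' G.
Proof.
move=> k0 hred hr hs hred' h.
have h' := k_equivalent_sym h.
have hr' := k_equivalent_has_rank h' hr.
have hs' : ~ spin G' by move=> /(k_equivalent_spin h').
have [a [c [[ea fa]|[ea fa]]]] := reduced_rank2_nonspin k hred hr hs.
  have [b [d [[eb fb]|[eb fb]]]] := reduced_rank2_nonspin k hred' hr' hs'.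
    have [m11 [m12 [m21 [m22 [dt hF]]]]] := k_equivalent_form h fb fa.
    have hab := degenerate_form_equiv k0 dt hF.
    apply: eq_reduced_class_trans eb _.
    exact: eq_reduced_class_trans (theta_pair_eq_reduced_class hab) (eq_reduced_class_sym ea).
  have [m11 [m12 [m21 [m22 [dt hF]]]]] := k_equivalent_form h fb fa.
  by case: (nondegenerate_not_degenerate hF).
have [b [d [[eb fb]|[eb fb]]]] := reduced_rank2_nonspin k hred' hr' hs'.
  have [m11 [m12 [m21 [m22 [dt hF]]]]] := k_equivalent_form h' fa fb.
  by case: (nondegenerate_not_degenerate hF).
have [m11 [m12 [m21 [m22 [dt hF]]]]] := k_equivalent_form h fb fa.
have hab := nondegenerate_form_equiv k0 hF; subst b.
exact: eq_reduced_class_trans eb (eq_reduced_class_sym ea).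
Qed.

Theorem proposition4p12 (k : nat) (G : plumbing_graph)
    (hk : (0 < k)%N) (hred : reduced G) (hrank : has_rank G 2) :
  (spin G ->
    ((exists a1 a2 : int,
        graph_iso G (disjoint_union (isolated_vertex a1 0 0)
                                    (isolated_vertex a2 0 0)))
     \/ (exists a : 'I_3 -> int,
           (forall i, a i <> 0) /\ graph_iso G (star3 a)))
    /\ (forall G1 G2 : plumbing_graph,
          reduced G1 -> reduced G2 ->
          k_equivalent k G1 G -> ~ eq_reduced_class G1 G ->
          k_equivalent k G2 G -> ~ eq_reduced_class G2 G ->
          eq_reduced_class G1 G2))
  /\
  (~ spin G ->
    (exists a : int,
        eq_reduced_class G (disjoint_union Theta (isolated_vertex a 0 0))
        \/ eq_reduced_class G (isolated_vertex a 1 0))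
    /\ (forall G' : plumbing_graph,
          reduced G' -> k_equivalent k G' G -> eq_reduced_class G' G)).
Proof.
split=> hs; split.
- have [a1 [a2 [a3 [c [[[_ hG]|[a [na hG _]]] _]]]]] := reduced_rank2_spin k hred hrank hs.
    by left; exists a1, a2.
  by right; exists a.
- move=> G1 G2 h1 h2 e1 n1 e2 n2.
  by have [] := spin_k_equivalent_trichotomy hk hred hrank hs h1 h2 e1 e2.
- have [a [c [[h _]|[h _]]]] := reduced_rank2_nonspin k hred hrank hs; exists a.
    by left.
  by right.
- move=> G' h e; exact: nonspin_k_equivalent_unique hk hred hrank hs h e.
Qed.
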